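(* The operator $T:\ell^2(\mathbb{Z}\times\mathbb{Z})\to L^2(\mathbb{Z}\times[-\pi,\pi])$ is injective.
   Context: Fix a complex number $g_\omega\neq 0$ (coupling constant). For $\theta\in[-\pi,\pi]$ let $U_\omega(\theta)$ be the unitary operator on $\ell^2(\mathbb{Z})$ with matrix entries $(U_\omega(\theta))_{k,l}=e^{\mathrm{i}(k-l)\theta}J_{k-l}(2|g_\omega|)$, $k,l\in\mathbb{Z}$, where $J_n$ is the Bessel function of the first kind of order $n$. The forward operator $T:\ell^2(\mathbb{Z}\times\mathbb{Z})\to L^2(\mathbb{Z}\times[-\pi,\pi])$ (the target space carries counting measure times Lebesgue measure) is the bounded linear operator $$(T\rho)(l,\theta)=\big(U_\omega(\theta)\rho\,U_\omega(\theta)^*\big)_{l,l}=\sum_{m,n\in\mathbb{Z}}e^{\mathrm{i}(l-m)\theta}J_{l-m}(2|g_\omega|)\,\rho_{m,n}\,e^{-\mathrm{i}(l-n)\theta}J_{l-n}(2|g_\omega|),$$ where a matrix $\rho=(\rho_{j,k})_{j,k\in\mathbb{Z}}\in\ell^2(\mathbb{Z}\times\mathbb{Z})$ is identified with a Hilbert–Schmidt operator on $\ell^2(\mathbb{Z})$. *)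

(* Defs.v *)
From Stdlib Require Import Reals Lra Lia ZArith List ClassicalEpsilon.
Open Scope R_scope.

Definition Cx : Type := (R * R)%type.
Definition C0 : Cx := (0, 0).
Definition Cadd (z w : Cx) : Cx := (fst z + fst w, snd z + snd w).
Definition Cmul (z w : Cx) : Cx :=
  (fst z * fst w - snd z * snd w, fst z * snd w + snd z * fst w).
Definition Cconj (z : Cx) : Cx := (fst z, - snd z).
Definition Cscale (r : R) (z : Cx) : Cx := (r * fst z, r * snd z).
Definition Cmod (z : Cx) : R := sqrt (fst z ^ 2 + snd z ^ 2).
Definition Cnorm2 (z : Cx) : R := fst z ^ 2 + snd z ^ 2.
Definition Cexpi (t : R) : Cx := (cos t, sin t).

(** Bessel function of the first kind, J_n(x) for n : nat, defined by its
    power series  sum_k (-1)^k / (k! (k+n)!) (x/2)^(2k+n)  (which converges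
    for all x; the value is selected by Hilbert's epsilon). *)
Definition bessel_term (n : nat) (x : R) (k : nat) : R :=
  (-1) ^ k / (INR (fact k) * INR (fact (k + n))) * (x / 2) ^ (2 * k + n).
Definition besselJ_nat (n : nat) (x : R) : R :=
  epsilon (inhabits 0) (fun l => infinite_sum (bessel_term n x) l).
Definition besselJ (n : Z) (x : R) : R :=
  match n with
  | Z0 => besselJ_nat 0 x
  | Zpos p => besselJ_nat (Pos.to_nat p) x
  | Zneg p => (-1) ^ (Pos.to_nat p) * besselJ_nat (Pos.to_nat p) x
  end.

Definition Uentry (g : Cx) (theta : R) (k l : Z) : Cx :=
  Cscale (besselJ (k - l) (2 * Cmod g)) (Cexpi (IZR (k - l) * theta)).

Definition Zrange (N : nat) : list Z :=
  map (fun i => (Z.of_nat i - Z.of_nat N)%Z) (seq 0 (2 * N + 1)).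
Definition ZsumR (f : Z -> R) (N : nat) : R :=
  fold_right (fun k acc => f k + acc) 0 (Zrange N).
Definition ZsumC (f : Z -> Cx) (N : nat) : Cx :=
  fold_right (fun k acc => Cadd (f k) acc) C0 (Zrange N).

(** rho in l^2(Z x Z): the nonnegative double series sum |rho_{m,n}|^2 has
    bounded partial sums (equivalently, is finite). *)
Definition is_l2 (rho : Z -> Z -> Cx) : Prop :=
  exists M : R, forall N : nat,
    ZsumR (fun m => ZsumR (fun n => Cnorm2 (rho m n)) N) N <= M.

Definition Tterm (g : Cx) (rho : Z -> Z -> Cx) (l : Z) (theta : R) (m n : Z) : Cx :=
  Cmul (Cmul (Uentry g theta l m) (rho m n)) (Cconj (Uentry g theta l n)).

Definition Tpartial (g : Cx) (rho : Z -> Z -> Cx) (l : Z) (theta : R) (N : nat) : Cx :=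
  ZsumC (fun m => ZsumC (fun n => Tterm g rho l theta m n) N) N.

(** (T rho)(l, theta) = v : the (absolutely convergent) double series
    converges to v. *)
Definition T_value (g : Cx) (rho : Z -> Z -> Cx) (l : Z) (theta : R) (v : Cx) : Prop :=
  Un_cv (fun N => fst (Tpartial g rho l theta N)) (fst v) /\
  Un_cv (fun N => snd (Tpartial g rho l theta N)) (snd v).

Definition null_set (S : R -> Prop) : Prop :=
  forall eps : R, 0 < eps ->
    exists a b : nat -> R,
      (forall k, a k <= b k) /\
      (forall x, S x -> exists k, a k < x < b k) /\
      (forall n, sum_f_R0 (fun k => b k - a k) n <= eps).

Definition ae_on_pi (P : R -> Prop) : Prop :=
  exists Nset : R -> Prop, null_set Nset /\
    forall theta, -PI <= theta <= PI -> ~ Nset theta -> P theta.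

(** T rho1 = T rho2 as elements of L^2(Z x [-pi,pi]). *)
Definition T_equal (g : Cx) (rho1 rho2 : Z -> Z -> Cx) : Prop :=
  forall l : Z, ae_on_pi (fun theta =>
    forall v1 v2 : Cx, T_value g rho1 l theta v1 -> T_value g rho2 l theta v2 -> v1 = v2).

(* Main.v *)
(** Let rho = rho1 - rho2. For fixed l the difference of the two images is a trigonometric series
    in theta with absolutely summable coefficients, so it vanishes everywhere once it vanishes
    almost everywhere, and its Fourier coefficients are zero: for all l and d,
    sum_m J_{l-m} J_{l-m-d} rho_{m,m+d} = 0. It remains to see that a convolution equation
    a * r = 0 with r in l^2 and a nonzero and superexponentially decaying forces r = 0.

    Put f(t) = sum_k a_k e^{ikt} and phi(t) = sum_k r_k e^{ikt}, so that f phi = 0 in L^2. Then also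
    f' phi = 0: for y the real or imaginary part of f and s > 0,
    the integral of y'^2 / (1 + (y/s)^2) is O(s) by parts, while 1 - 1 / (1 + (y/s)^2) <= (y/s)^2
    kills phi. Hence sum_k P(k) a_k e^{ikt} annihilates phi for every polynomial P. Taking for P
    partial products of sin(pi (k - k0)) / (pi (k - k0)) the coefficients P(k) a_k tend in l^1 to
    the delta sequence a_{k0} delta_{k0}, so phi = 0. *)

From Stdlib Require Import Reals ZArith.
From Stdlib Require Import Lra Lia List ClassicalEpsilon Classical FunctionalExtensionality.
From Coquelicot Require Import Rcomplements Hierarchy Continuity Derive RInt RInt_analysis Series AutoDerive ElemFct.
Require Import Defs.
Open Scope R_scope.

(** The classical ending would be that f is analytic, so its zeros are isolated and phi vanishes off
    a null set. Here phi is only a square-summable sequence without pointwise values. The passage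
    from f to f' replaces that argument: it is a quantitative form of the fact that a smooth
    function has zero derivative at almost all of its zeros, and it can be stated for truncations
    alone.

    Decay of a is needed twice: every polynomial multiple of a must be summable, and the
    interpolating products, which equal the Kronecker delta on a growing window, must be harmless
    outside it. There they are at most 9^|k - k0|, so summability of a against the weight 9^|k|
    serves both purposes.

    The Bessel values are real, so the equation on each diagonal of rho separates into one for the
    real parts and one for the imaginary parts. This is why a and r are real sequences
    throughout. *)

(** * Symmetric sums over the integers *)

(** Summation over an arbitrary list lets shifted or reflected windows be compared with [Zrange] by
    inclusion. *)
Definition lsum (L : list Z) (f : Z -> R) : R :=
  fold_right (fun k acc => f k + acc) 0 L.

Lemma lsum_cons x L f : lsum (x :: L) f = f x + lsum L f.
Proof. reflexivity. Qed.

Lemma lsum_app L1 L2 f : lsum (L1 ++ L2) f = lsum L1 f + lsum L2 f.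
Proof. induction L1; simpl app; rewrite ?lsum_cons; [unfold lsum at 2; simpl|]; lra. Qed.

Lemma lsum_map (h : Z -> Z) L f : lsum (map h L) f = lsum L (fun k => f (h k)).
Proof. induction L; simpl map; rewrite ?lsum_cons, ?IHL; reflexivity. Qed.

Lemma lsum_nonneg L f : (forall k, 0 <= f k) -> 0 <= lsum L f.
Proof. intros H; induction L; rewrite ?lsum_cons; [simpl; lra | specialize (H a); lra]. Qed.

Lemma lsum_incl L L' f : (forall k, 0 <= f k) -> NoDup L -> incl L L' ->
  lsum L f <= lsum L' f.
Proof.
  intros H; revert L'; induction L as [|x L IH]; intros L' HN HI.
  - apply lsum_nonneg, H.
  - destruct (in_split x L') as (l1 & l2 & ->); [apply HI; now left|].
    inversion HN as [|? ? Hx HN']; subst.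
    assert (Hi : incl L (l1 ++ l2)).
    { intros z Hz. specialize (HI z (or_intror Hz)).
      apply in_app_or in HI. apply in_or_app.
      destruct HI as [|[E|]]; auto. subst; contradiction. }
    specialize (IH _ HN' Hi). rewrite lsum_app in *. rewrite !lsum_cons. lra.
Qed.

Lemma ZsumR_lsum f N : ZsumR f N = lsum (Zrange N) f.
Proof. reflexivity. Qed.

Lemma Zrange_S N :
  Zrange (S N) = (- Z.of_nat (S N))%Z :: Zrange N ++ (Z.of_nat (S N) :: nil).
Proof.
  unfold Zrange.
  replace (2 * S N + 1)%nat with (S (S (2 * N + 1))) by lia.
  rewrite seq_S, map_app. cbn [seq map app].
  rewrite <- seq_shift, map_map. f_equal. f_equal.
  - apply map_ext; intros; lia.
  - f_equal; lia.
Qed.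

Lemma in_Zrange N k : In k (Zrange N) <-> (Z.abs k <= Z.of_nat N)%Z.
Proof.
  unfold Zrange; rewrite in_map_iff; split.
  - intros (i & <- & Hi). apply in_seq in Hi. lia.
  - intros H. exists (Z.to_nat (k + Z.of_nat N)). split; [lia|]. apply in_seq. lia.
Qed.

Lemma NoDup_Zrange N : NoDup (Zrange N).
Proof.
  unfold Zrange. apply NoDup_map_NoDup_ForallPairs; [|apply seq_NoDup].
  intros i j _ _ H; lia.
Qed.

Lemma ZsumR_0 f : ZsumR f 0 = f 0%Z.
Proof. unfold ZsumR, Zrange; simpl. lra. Qed.

Lemma ZsumR_S f N :
  ZsumR f (S N) = ZsumR f N + (f (Z.of_nat (S N)) + f (- Z.of_nat (S N))%Z).
Proof.
  rewrite !ZsumR_lsum, Zrange_S, lsum_cons, lsum_app, lsum_cons.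
  change (lsum nil f) with 0; lra.
Qed.

Lemma ZsumR_ext_le f g N :
  (forall k, (Z.abs k <= Z.of_nat N)%Z -> f k = g k) -> ZsumR f N = ZsumR g N.
Proof.
  induction N; intros H.
  - rewrite !ZsumR_0. apply H; simpl; lia.
  - rewrite !ZsumR_S, IHN, !H by (intros; try apply H; lia). reflexivity.
Qed.

Lemma ZsumR_ext f g N : (forall k, f k = g k) -> ZsumR f N = ZsumR g N.
Proof. intros; apply ZsumR_ext_le; auto. Qed.

Lemma ZsumR_le_in f g N :
  (forall k, (Z.abs k <= Z.of_nat N)%Z -> f k <= g k) -> ZsumR f N <= ZsumR g N.
Proof.
  induction N; intros H.
  - rewrite !ZsumR_0. apply H; simpl; lia.
  - rewrite !ZsumR_S.
    assert (H1 := H (Z.of_nat (S N)) ltac:(lia)).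
    assert (H2 := H (- Z.of_nat (S N))%Z ltac:(lia)).
    assert (H3 : ZsumR f N <= ZsumR g N) by (apply IHN; intros; apply H; lia). lra.
Qed.

Lemma ZsumR_le f g N : (forall k, f k <= g k) -> ZsumR f N <= ZsumR g N.
Proof. intros; apply ZsumR_le_in; auto. Qed.

Lemma ZsumR_plus f g N : ZsumR (fun k => f k + g k) N = ZsumR f N + ZsumR g N.
Proof. induction N; rewrite ?ZsumR_0, ?ZsumR_S; lra. Qed.

Lemma ZsumR_minus f g N : ZsumR (fun k => f k - g k) N = ZsumR f N - ZsumR g N.
Proof. induction N; rewrite ?ZsumR_0, ?ZsumR_S; lra. Qed.

Lemma ZsumR_scal c f N : ZsumR (fun k => c * f k) N = c * ZsumR f N.
Proof. induction N; rewrite ?ZsumR_0, ?ZsumR_S; lra. Qed.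

Lemma ZsumR_scal_r c f N : ZsumR (fun k => f k * c) N = ZsumR f N * c.
Proof. induction N; rewrite ?ZsumR_0, ?ZsumR_S; lra. Qed.

Lemma ZsumR_zero N : ZsumR (fun _ => 0) N = 0.
Proof. induction N; rewrite ?ZsumR_0, ?ZsumR_S; lra. Qed.

Lemma ZsumR_nonneg f N : (forall k, 0 <= f k) -> 0 <= ZsumR f N.
Proof. apply lsum_nonneg. Qed.

Lemma ZsumR_abs f N : Rabs (ZsumR f N) <= ZsumR (fun k => Rabs (f k)) N.
Proof.
  induction N; rewrite ?ZsumR_0, ?ZsumR_S; [lra|].
  eapply Rle_trans; [apply Rabs_triang|].
  apply Rplus_le_compat; [exact IHN | apply Rabs_triang].
Qed.

Lemma ZsumR_swap (f : Z -> Z -> R) N M :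
  ZsumR (fun k => ZsumR (f k) M) N = ZsumR (fun m => ZsumR (fun k => f k m) N) M.
Proof.
  induction N.
  - rewrite ZsumR_0. apply ZsumR_ext; intros; now rewrite ZsumR_0.
  - rewrite ZsumR_S, IHN.
    rewrite <- !ZsumR_plus. apply ZsumR_ext; intros. now rewrite ZsumR_S.
Qed.

Lemma ZsumR_mono f N M : (forall k, 0 <= f k) -> (N <= M)%nat -> ZsumR f N <= ZsumR f M.
Proof.
  intros H HN; induction HN; [lra|]. rewrite ZsumR_S.
  pose proof (H (Z.of_nat (S m))); pose proof (H (- Z.of_nat (S m))%Z); lra.
Qed.

Lemma ZsumR_ge_term f N k : (forall k, 0 <= f k) -> (Z.abs k <= Z.of_nat N)%Z ->
  f k <= ZsumR f N.
Proof.
  intros H Hk. replace (f k) with (lsum (k :: nil) f) by (simpl; lra).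
  apply lsum_incl; auto.
  - repeat constructor; simpl; tauto.
  - intros z [<-|[]]; now apply in_Zrange.
Qed.

Lemma ZsumR_shift_le f N c : (forall k, 0 <= f k) ->
  ZsumR (fun k => f (c - k)%Z) N <= ZsumR f (N + Z.abs_nat c).
Proof.
  intros H. rewrite !ZsumR_lsum, <- (lsum_map (fun k => (c - k)%Z)).
  apply lsum_incl; auto.
  - apply NoDup_map_NoDup_ForallPairs; [|apply NoDup_Zrange]. intros i j _ _ E; lia.
  - intros z Hz. apply in_map_iff in Hz as (k & <- & Hk).
    apply in_Zrange in Hk. apply in_Zrange. lia.
Qed.

Lemma ZsumR_delta f q N :
  ZsumR (fun k => if (k =? q)%Z then f k else 0) N =
  if (Z.abs q <=? Z.of_nat N)%Z then f q else 0.
Proof.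
  induction N.
  - rewrite ZsumR_0. destruct (Z.eqb_spec 0 q); destruct (Z.leb_spec (Z.abs q) (Z.of_nat 0)); subst; simpl in *; try lia; reflexivity.
  - rewrite ZsumR_S, IHN.
    destruct (Z.leb_spec (Z.abs q) (Z.of_nat N)); destruct (Z.leb_spec (Z.abs q) (Z.of_nat (S N)));
    destruct (Z.eqb_spec (Z.of_nat (S N)) q); destruct (Z.eqb_spec (- Z.of_nat (S N)) q);
    try lia; subst; lra.
Qed.

Lemma ZsumR_outside f N M : (N <= M)%nat ->
  ZsumR (fun k => if (Z.abs k <=? Z.of_nat N)%Z then 0 else f k) M = ZsumR f M - ZsumR f N.
Proof.
  intros H; induction H.
  - rewrite (ZsumR_ext_le _ (fun _ => 0)), ZsumR_zero; [lra|].
    intros k Hk. apply Z.leb_le in Hk. now rewrite Hk.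
  - rewrite !ZsumR_S, IHle.
    destruct (Z.leb_spec (Z.abs (Z.of_nat (S m))) (Z.of_nat N)); [lia|].
    destruct (Z.leb_spec (Z.abs (- Z.of_nat (S m))) (Z.of_nat N)); [lia|]. lra.
Qed.

Definition summable (f : Z -> R) : Prop :=
  exists M, forall N, ZsumR (fun k => Rabs (f k)) N <= M.

Lemma ZsumR_tail f M : (forall k, 0 <= f k) -> (forall N, ZsumR f N <= M) ->
  forall eps, 0 < eps -> exists N0, forall N N', (N0 <= N <= N')%nat ->
    ZsumR f N' - ZsumR f N <= eps.
Proof.
  intros Hf HM eps He.
  destruct (growing_cv (ZsumR f)) as [l Hl].
  - intros N. apply ZsumR_mono; auto.
  - exists M. intros x [N ->]. apply HM.
  - destruct (Hl (eps / 2) ltac:(lra)) as [N0 H0]. exists N0. intros N N' HN.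
    pose proof (H0 N ltac:(lia)) as H1. pose proof (H0 N' ltac:(lia)) as H2.
    unfold Rdist in *. apply Rabs_def2 in H1; apply Rabs_def2 in H2. lra.
Qed.

(** * Null sets *)

(* The supremum of those y for which [alpha, y] is no longer than what finitely
   many of the intervals cut out of it can be pushed beyond any point of (alpha, beta). *)
Lemma interval_cover_length (a b : nat -> R) alpha beta :
  (forall k, a k <= b k) -> alpha < beta ->
  (forall x, alpha <= x <= beta -> exists k, a k < x < b k) ->
  exists n, beta - alpha <= sum_f_R0 (fun k => b k - a k) n.
Proof.
  intros Hab Hlt Hcov.
  (* [lam x k] is the length of the part of the k-th interval inside [alpha, x]; [E] collects the
     points x up to which finitely many of these lengths suffice. *)
  set (lam := fun (x : R) (k : nat) => Rmax 0 (Rmin (b k) x - Rmax (a k) alpha)).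
  set (E := fun x => alpha <= x <= beta /\ exists n, x - alpha <= sum_f_R0 (lam x) n).
  assert (lam0 : forall x k, 0 <= lam x k) by (intros; apply Rmax_l).
  assert (lam_mono : forall x y k, x <= y -> lam x k <= lam y k).
  { intros x y k Hxy. unfold lam. apply Rle_max_compat_l.
    pose proof (Rle_min_compat_l x y (b k) Hxy). lra. }
  assert (Hmono : forall x n m, (n <= m)%nat -> sum_f_R0 (lam x) n <= sum_f_R0 (lam x) m).
  { intros x n m H; induction H; [lra|]. simpl. specialize (lam0 x (S m)); lra. }
  (* While x moves to y inside one interval, that interval alone contributes the whole increase y -
     x. *)
  assert (Hjump : forall x y k n, alpha <= x <= y -> a k < x -> y < b k -> (k <= n)%nat ->
            sum_f_R0 (lam x) n + (y - x) <= sum_f_R0 (lam y) n).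
  { intros x y k n Hxy Hax Hyb Hkn.
    assert (Hk : lam y k = lam x k + (y - x)).
    { unfold lam. rewrite !(Rmin_right (b k)) by lra.
      assert (Rmax (a k) alpha <= x) by (apply Rmax_lub; lra).
      rewrite !(Rmax_right 0) by lra. lra. }
    induction Hkn.
    - destruct k; simpl; [lra|].
      assert (sum_f_R0 (lam x) k <= sum_f_R0 (lam y) k)
        by (apply sum_Rle; intros; apply lam_mono; lra). lra.
    - simpl. specialize (lam_mono x y (S m) ltac:(lra)). lra. }
  assert (Ea : E alpha).
  { split; [lra|]. exists 0%nat. simpl. specialize (lam0 alpha 0%nat); lra. }
  destruct (completeness E) as [s [Hub Hlub]].
  { exists beta. intros x [H _]; lra. }
  { now exists alpha. }
  assert (Has : alpha <= s) by (apply Hub, Ea).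
  assert (Hsb : s <= beta) by (apply Hlub; intros x [H _]; lra).
  (* The interval that covers the supremum also contains a point of [E], from which [Hjump] carries
     [E] past s unless s = beta. *)
  destruct (Hcov s ltac:(lra)) as [k Hk].
  assert (Hx : exists x, E x /\ a k < x).
  { apply NNPP; intros Hn. assert (s <= a k); [|lra].
    apply Hlub. intros x Hx. apply Rnot_lt_le; intros Hc. apply Hn; eauto. }
  destruct Hx as (x & [Hx1 [n Hn]] & Hax).
  assert (Hxs : x <= s) by (apply Hub; split; eauto).
  assert (Hy : forall y, x <= y <= beta -> y < b k -> E y).
  { intros y Hy Hyb. split; [lra|]. exists (max n k).
    pose proof (Hjump x y k (max n k) ltac:(lra) Hax Hyb ltac:(lia)).
    pose proof (Hmono x n (max n k) ltac:(lia)). lra. }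
  assert (Es : s = beta).
  { apply Rle_antisym; [easy|]. apply Rnot_lt_le; intros Hc.
    set (y := Rmin beta ((s + b k) / 2)).
    assert (s < y) by (apply Rmin_glb_lt; lra).
    assert (y <= beta) by apply Rmin_l.
    assert (y <= (s + b k) / 2) by apply Rmin_r.
    assert (E y) by (apply Hy; lra). assert (y <= s) by now apply Hub. lra. }
  destruct (Hy beta) as [_ [m Hm]]; [lra|lra|].
  exists m. eapply Rle_trans; [exact Hm|]. apply sum_Rle; intros i _.
  unfold lam. apply Rmax_lub; [specialize (Hab i); lra|].
  pose proof (Rmin_l (b i) beta). pose proof (Rmax_l (a i) alpha). lra.
Qed.

Lemma null_set_not_interval S alpha beta : null_set S -> alpha < beta ->
  exists x, alpha < x < beta /\ ~ S x.
Proof.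
  intros HS Hlt. apply NNPP; intros Hn.
  (* The covering lemma wants a closed interval, so it is applied to the middle third [u, v], at
     half its length. *)
  set (u := (2 * alpha + beta) / 3). set (v := (alpha + 2 * beta) / 3).
  destruct (HS ((v - u) / 2) ltac:(unfold u, v; lra)) as (a & b & Hab & Hc & Hs).
  destruct (interval_cover_length a b u v Hab ltac:(unfold u, v; lra)) as [n H].
  - intros x Hx. apply Hc. apply NNPP; intros HSx. apply Hn. exists x.
    split; [unfold u, v in *; lra | easy].
  - specialize (Hs n). unfold u, v in *. lra.
Qed.

(** * Trigonometric polynomials *)

Definition cont (f : R -> R) : Prop := forall t, continuous f t.

Lemma cont_const c : cont (fun _ => c).
Proof. intros t; apply continuous_const. Qed.

Lemma cont_plus f g : cont f -> cont g -> cont (fun t => f t + g t).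
Proof. intros Hf Hg t; apply (continuous_plus f g); auto. Qed.

Lemma cont_minus f g : cont f -> cont g -> cont (fun t => f t - g t).
Proof. intros Hf Hg t; apply (continuous_minus f g); auto. Qed.

Lemma cont_mult f g : cont f -> cont g -> cont (fun t => f t * g t).
Proof. intros Hf Hg t; apply (continuous_mult f g); auto. Qed.

Lemma cont_pow f n : cont f -> cont (fun t => f t ^ n).
Proof. intros Hf; induction n; simpl; [apply cont_const | now apply cont_mult]. Qed.

Lemma cont_derive f df : (forall t, is_derive f t (df t)) -> cont f.
Proof. intros H t. apply (ex_derive_continuous f). now exists (df t). Qed.

#[local] Hint Resolve cont_const cont_plus cont_minus cont_mult cont_pow : cont.

(** * Integration over [-pi, pi] *)

Definition Int (f : R -> R) : R := RInt f (- PI) PI.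

Lemma cont_ex_RInt f a b : cont f -> ex_RInt f a b.
Proof. intros H; apply (ex_RInt_continuous f); auto. Qed.
#[local] Hint Resolve cont_ex_RInt : cont.

Lemma Int_plus f g : cont f -> cont g -> Int (fun t => f t + g t) = Int f + Int g.
Proof. intros; apply (RInt_plus f g); auto with cont. Qed.

Lemma Int_minus f g : cont f -> cont g -> Int (fun t => f t - g t) = Int f - Int g.
Proof. intros; apply (RInt_minus f g); auto with cont. Qed.

Lemma Int_scal c f : cont f -> Int (fun t => c * f t) = c * Int f.
Proof. intros; apply (RInt_scal f); auto with cont. Qed.

Lemma Int_ext f g : (forall t, f t = g t) -> Int f = Int g.
Proof. intros; apply RInt_ext; auto. Qed.

Lemma Int_le f g : cont f -> cont g ->
  (forall t, - PI <= t <= PI -> f t <= g t) -> Int f <= Int g.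
Proof.
  intros; apply RInt_le; auto with cont.
  - pose proof PI_RGT_0; lra.
  - intros; apply H1; lra.
Qed.

Lemma Int_const c : Int (fun _ => c) = 2 * PI * c.
Proof. unfold Int. rewrite RInt_const. unfold scal; simpl; unfold mult; simpl. ring. Qed.

Lemma Int_abs_le f c : cont f -> (forall t, - PI <= t <= PI -> Rabs (f t) <= c) ->
  Rabs (Int f) <= 2 * PI * c.
Proof.
  intros Hf H. apply Rabs_le. split.
  - replace (- (2 * PI * c)) with (Int (fun _ => - c)) by (rewrite Int_const; ring).
    apply Int_le; auto with cont. intros t Ht. specialize (H t Ht). apply Rabs_le_between in H. lra.
  - rewrite <- Int_const. apply Int_le; auto with cont.
    intros t Ht. specialize (H t Ht). apply Rabs_le_between in H. lra.
Qed.

Lemma cont_ZsumR (f : Z -> R -> R) N :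
  (forall k, cont (f k)) -> cont (fun t => ZsumR (fun k => f k t) N).
Proof.
  intros H. unfold ZsumR. induction (Zrange N); simpl; [apply cont_const|].
  now apply cont_plus.
Qed.
#[local] Hint Resolve cont_ZsumR : cont.

Lemma is_derive_ZsumR (f : Z -> R -> R) df t N :
  (forall k, is_derive (f k) t (df k)) ->
  is_derive (fun t => ZsumR (fun k => f k t) N) t (ZsumR df N).
Proof.
  intros H. unfold ZsumR. induction (Zrange N); simpl.
  - apply (is_derive_const 0).
  - apply (is_derive_plus (f a)); auto.
Qed.

Lemma Int_ZsumR (f : Z -> R -> R) N : (forall k, cont (f k)) ->
  Int (fun t => ZsumR (fun k => f k t) N) = ZsumR (fun k => Int (f k)) N.
Proof.
  intros H. unfold ZsumR. induction (Zrange N); simpl.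
  - rewrite Int_const; ring.
  - rewrite Int_plus, IHl; auto.
    clear -H. induction l; simpl; [apply cont_const|]. now apply cont_plus.
Qed.

Lemma cont_cos c : cont (fun t => cos (c * t)).
Proof. apply (cont_derive _ (fun t => - c * sin (c * t))). intros; auto_derive; auto; ring. Qed.
Lemma cont_sin c : cont (fun t => sin (c * t)).
Proof. apply (cont_derive _ (fun t => c * cos (c * t))). intros; auto_derive; auto; ring. Qed.
#[local] Hint Resolve cont_cos cont_sin : cont.

Lemma sin_IZR_PI j : sin (IZR j * PI) = 0.
Proof. apply sin_eq_0_1. now exists j. Qed.

Lemma Int_cos j : Int (fun t => cos (IZR j * t)) = if (j =? 0)%Z then 2 * PI else 0.
Proof.
  destruct (Z.eqb_spec j 0) as [->|Hj].
  - rewrite (Int_ext _ (fun _ => 1)), Int_const; [ring|].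
    intros; now rewrite Rmult_0_l, cos_0.
  - apply not_0_IZR in Hj. apply is_RInt_unique.
    replace 0 with (minus (sin (IZR j * PI) / IZR j) (sin (IZR j * - PI) / IZR j)).
    + apply (is_RInt_derive (fun t => sin (IZR j * t) / IZR j)).
      * intros; auto_derive; auto; now field.
      * intros; apply cont_cos.
    + unfold minus, plus, opp; simpl.
      rewrite <- Ropp_mult_distr_r, sin_neg, sin_IZR_PI. field; auto.
Qed.

Lemma Int_sin j : Int (fun t => sin (IZR j * t)) = 0.
Proof.
  destruct (Z.eqb_spec j 0) as [->|Hj].
  - rewrite (Int_ext _ (fun _ => 0)), Int_const; [ring|].
    intros; now rewrite Rmult_0_l, sin_0.
  - apply not_0_IZR in Hj. apply is_RInt_unique.
    replace 0 with (minus (- cos (IZR j * PI) / IZR j) (- cos (IZR j * - PI) / IZR j)).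
    + apply (is_RInt_derive (fun t => - cos (IZR j * t) / IZR j)).
      * intros; auto_derive; auto; now field.
      * intros; apply cont_sin.
    + unfold minus, plus, opp; simpl.
      rewrite <- Ropp_mult_distr_r, cos_neg. field; auto.
Qed.

(* Real and imaginary part of the trigonometric polynomial sum_{|k| <= N} c_k e^{ikt},
   and the square of its modulus. *)
Definition Cs (c : Z -> R) (N : nat) (t : R) : R := ZsumR (fun k => c k * cos (IZR k * t)) N.
Definition Sn (c : Z -> R) (N : nat) (t : R) : R := ZsumR (fun k => c k * sin (IZR k * t)) N.
Definition Nrm (c : Z -> R) (N : nat) (t : R) : R := Cs c N t ^ 2 + Sn c N t ^ 2.

Lemma cont_Cs c N : cont (Cs c N).
Proof. apply cont_ZsumR; intros; auto with cont. Qed.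
Lemma cont_Sn c N : cont (Sn c N).
Proof. apply cont_ZsumR; intros; auto with cont. Qed.
#[local] Hint Resolve cont_Cs cont_Sn : cont.
Lemma cont_Nrm c N : cont (Nrm c N).
Proof. unfold Nrm; auto with cont. Qed.
#[local] Hint Resolve cont_Nrm : cont.

Lemma Nrm_nonneg c N t : 0 <= Nrm c N t.
Proof. unfold Nrm. pose proof (pow2_ge_0 (Cs c N t)); pose proof (pow2_ge_0 (Sn c N t)); lra. Qed.

Lemma Cs_abs_le c N t : Rabs (Cs c N t) <= ZsumR (fun k => Rabs (c k)) N.
Proof.
  eapply Rle_trans; [apply ZsumR_abs|]. apply ZsumR_le; intros k.
  rewrite Rabs_mult. pose proof (Rabs_pos (c k)).
  assert (Rabs (cos (IZR k * t)) <= 1) by (apply Rabs_le; apply COS_bound). nra.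
Qed.

Lemma Sn_abs_le c N t : Rabs (Sn c N t) <= ZsumR (fun k => Rabs (c k)) N.
Proof.
  eapply Rle_trans; [apply ZsumR_abs|]. apply ZsumR_le; intros k.
  rewrite Rabs_mult. pose proof (Rabs_pos (c k)).
  assert (Rabs (sin (IZR k * t)) <= 1) by (apply Rabs_le; apply SIN_bound). nra.
Qed.

Lemma Nrm_le c N t M : ZsumR (fun k => Rabs (c k)) N <= M -> Nrm c N t <= 2 * M ^ 2.
Proof.
  intros H. unfold Nrm.
  pose proof (Cs_abs_le c N t) as H1. pose proof (Sn_abs_le c N t) as H2.
  assert (Rabs (Cs c N t) ^ 2 <= M ^ 2) by (apply pow_incr; split; [apply Rabs_pos|lra]).
  assert (Rabs (Sn c N t) ^ 2 <= M ^ 2) by (apply pow_incr; split; [apply Rabs_pos|lra]).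
  rewrite !pow2_abs in *. lra.
Qed.

Lemma Cs_plus c d N t : Cs (fun k => c k + d k) N t = Cs c N t + Cs d N t.
Proof. unfold Cs. rewrite <- ZsumR_plus. apply ZsumR_ext; intros; ring. Qed.
Lemma Sn_plus c d N t : Sn (fun k => c k + d k) N t = Sn c N t + Sn d N t.
Proof. unfold Sn. rewrite <- ZsumR_plus. apply ZsumR_ext; intros; ring. Qed.

Lemma Nrm_plus_le c d N t :
  Nrm (fun k => c k + d k) N t <= 2 * Nrm c N t + 2 * Nrm d N t.
Proof.
  unfold Nrm. rewrite Cs_plus, Sn_plus.
  pose proof (pow2_ge_0 (Cs c N t - Cs d N t)). pose proof (pow2_ge_0 (Sn c N t - Sn d N t)). nra.
Qed.

Lemma Nrm_scal a c N t : Nrm (fun k => a * c k) N t = a ^ 2 * Nrm c N t.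
Proof.
  unfold Nrm.
  replace (Cs (fun k => a * c k) N t) with (a * Cs c N t)
    by (unfold Cs; rewrite <- ZsumR_scal; apply ZsumR_ext; intros; ring).
  replace (Sn (fun k => a * c k) N t) with (a * Sn c N t)
    by (unfold Sn; rewrite <- ZsumR_scal; apply ZsumR_ext; intros; ring).
  ring.
Qed.

Lemma Nrm_ext c d N t : (forall k, c k = d k) -> Nrm c N t = Nrm d N t.
Proof.
  intros H. unfold Nrm, Cs, Sn.
  rewrite (ZsumR_ext (fun k => c k * cos (IZR k * t)) (fun k => d k * cos (IZR k * t)))
    by (intros; now rewrite H).
  rewrite (ZsumR_ext (fun k => c k * sin (IZR k * t)) (fun k => d k * sin (IZR k * t)))
    by (intros; now rewrite H). reflexivity.
Qed.

Definition trunc (c : Z -> R) (n : nat) (k : Z) : R :=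
  if (Z.abs k <=? Z.of_nat n)%Z then c k else 0.
Definition tail (c : Z -> R) (n : nat) (k : Z) : R :=
  if (Z.abs k <=? Z.of_nat n)%Z then 0 else c k.

Lemma Cs_tail c n N t : (n <= N)%nat -> Cs (tail c n) N t = Cs c N t - Cs c n t.
Proof.
  intros H. unfold Cs. rewrite <- (ZsumR_outside _ n N H). apply ZsumR_ext; intros k.
  unfold tail. destruct (Z.abs k <=? Z.of_nat n)%Z; ring.
Qed.
Lemma Sn_tail c n N t : (n <= N)%nat -> Sn (tail c n) N t = Sn c N t - Sn c n t.
Proof.
  intros H. unfold Sn. rewrite <- (ZsumR_outside _ n N H). apply ZsumR_ext; intros k.
  unfold tail. destruct (Z.abs k <=? Z.of_nat n)%Z; ring.
Qed.

Lemma Nrm_tail_le c n N t : (n <= N)%nat ->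
  Nrm c N t <= 2 * Nrm c n t + 2 * Nrm (tail c n) N t.
Proof.
  intros H. unfold Nrm. rewrite Cs_tail, Sn_tail by auto.
  (* With u the head and v the tail, 2 u^2 + 2 v^2 - (u + v)^2 = (v - u)^2, and v - u is the total
     minus twice the head. *)
  pose proof (pow2_ge_0 (Cs c N t - 2 * Cs c n t)).
  pose proof (pow2_ge_0 (Sn c N t - 2 * Sn c n t)). nra.
Qed.

(** Parseval's identity for a trigonometric polynomial: in the expanded square only the diagonal
    frequency k - j = 0 has a nonzero integral. *)
Lemma Int_Nrm c N : Int (Nrm c N) = 2 * PI * ZsumR (fun k => c k ^ 2) N.
Proof.
  rewrite (Int_ext _ (fun t => ZsumR (fun k => ZsumR (fun j =>
              (c k * c j) * cos (IZR (k - j) * t)) N) N)).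
  - rewrite Int_ZsumR by auto with cont.
    rewrite <- ZsumR_scal. apply ZsumR_ext_le; intros k Hk.
    rewrite Int_ZsumR by auto with cont.
    rewrite (ZsumR_ext _ (fun j => if (j =? k)%Z then 2 * PI * (c k * c j) else 0)).
    + rewrite ZsumR_delta. apply Z.leb_le in Hk. rewrite Hk. ring.
    + intros j. rewrite Int_scal, Int_cos by auto with cont.
      destruct (Z.eqb_spec (k - j) 0); destruct (Z.eqb_spec j k); try lia; ring.
  - intros t. unfold Nrm, Cs, Sn. simpl. rewrite !Rmult_1_r.
    rewrite <- !ZsumR_scal_r, <- ZsumR_plus. apply ZsumR_ext; intros k.
    rewrite <- !ZsumR_scal, <- ZsumR_plus. apply ZsumR_ext; intros j.
    rewrite minus_IZR, Rmult_minus_distr_r, cos_minus. ring.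
Qed.

Lemma Int_Nrm_tail c n N : (n <= N)%nat ->
  Int (Nrm (tail c n) N) = 2 * PI * (ZsumR (fun k => c k ^ 2) N - ZsumR (fun k => c k ^ 2) n).
Proof.
  intros H. rewrite Int_Nrm, <- (ZsumR_outside _ n N H). f_equal. apply ZsumR_ext; intros k.
  unfold tail. destruct (Z.abs k <=? Z.of_nat n)%Z; ring.
Qed.

(** On Fourier coefficients this is -i d/dt. *)
Definition kmul (b : Z -> R) (k : Z) : R := IZR k * b k.

Lemma is_derive_Cs c N t : is_derive (Cs c N) t (- Sn (kmul c) N t).
Proof.
  unfold Cs. evar_last.
  - apply (is_derive_ZsumR (fun k t => c k * cos (IZR k * t)) (fun k => - kmul c k * sin (IZR k * t))).
    intros k. unfold kmul. auto_derive; auto; ring.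
  - unfold Sn. replace (- ZsumR (fun k => kmul c k * sin (IZR k * t)) N)
      with (-1 * ZsumR (fun k => kmul c k * sin (IZR k * t)) N) by ring.
    rewrite <- ZsumR_scal. apply ZsumR_ext; intros; ring.
Qed.

Lemma is_derive_Sn c N t : is_derive (Sn c N) t (Cs (kmul c) N t).
Proof.
  apply (is_derive_ZsumR (fun k t => c k * sin (IZR k * t))).
  intros k. unfold kmul. auto_derive; auto; ring.
Qed.

(* Integrating by parts against s * atan (y / s), which is O(s) uniformly, shows that
   y' is small in mean square near the zeros of y; no information on the zero set is needed. *)
Lemma Int_derivative_concentration (y y1 y2 : R -> R) s c1 c2 : 0 < s ->
  (forall t, is_derive y t (y1 t)) -> (forall t, is_derive y1 t (y2 t)) -> cont y2 ->
  (forall t, Rabs (y1 t) <= c1) -> (forall t, Rabs (y2 t) <= c2) ->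
  cont (fun t => y1 t ^ 2 * / (1 + (y t / s) ^ 2)) /\
  Int (fun t => y1 t ^ 2 * / (1 + (y t / s) ^ 2)) <= s * (PI * c1 + PI ^ 2 * c2).
Proof.
  intros Hs Hy Hy1 Cy2 B1 B2.
  assert (Cy : cont y) by (eapply cont_derive; eauto).
  assert (Cy1 : cont y1) by (eapply cont_derive; eauto).
  assert (Cys : cont (fun t => y t / s)) by (apply cont_mult; auto with cont).
  assert (Cq : cont (fun t => y1 t ^ 2 * / (1 + (y t / s) ^ 2))).
  { apply cont_mult; auto with cont. intros t.
    apply (continuous_comp (fun t => 1 + (y t / s) ^ 2) Rinv).
    - apply (cont_plus (fun _ => 1) (fun t => (y t / s) ^ 2)); auto with cont.
    - apply continuous_Rinv. pose proof (pow2_ge_0 (y t / s)); lra. }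
  split; [exact Cq|].
  set (A := fun t => s * atan (y t / s)).
  assert (BA : forall t, Rabs (A t) <= s * (PI / 2)).
  { intros t. unfold A. rewrite Rabs_mult, (Rabs_right s) by lra.
    apply Rmult_le_compat_l; [lra|]. apply Rabs_le. pose proof (atan_bound (y t / s)); lra. }
  assert (HA : forall t, is_derive A t (y1 t * / (1 + (y t / s) ^ 2))).
  { intros t. unfold A. pose proof (Hy t) as Ht. auto_derive.
    - repeat split. exists (y1 t); exact Ht.
    - replace (Derive (fun x => y x) t) with (y1 t) by (symmetry; now apply is_derive_unique).
      unfold Rsqr. field.
      pose proof (pow2_ge_0 (y t)). split; [lra|nra]. }
  assert (CA : cont A) by exact (cont_derive A _ HA).
  (* Since A' = y' / (1 + (y/s)^2), the weighted square is y' A'. Each of the two boundary terms is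
     at most c1 s pi/2, and y'' A over length 2 pi gives at most pi^2 c2 s. *)
  assert (E : Int (fun t => y2 t * A t + y1 t ^ 2 * / (1 + (y t / s) ^ 2)) = y1 PI * A PI - y1 (- PI) * A (- PI)).
  { apply is_RInt_unique. apply (is_RInt_derive (fun t => y1 t * A t)).
    - intros t _. evar_last; [apply (is_derive_mult y1 A); [apply Hy1|apply HA|intros; apply Rmult_comm]|].
      unfold plus, mult; simpl. ring.
    - intros t _. apply (cont_plus (fun t => y2 t * A t)); auto with cont. }
  rewrite Int_plus in E; auto with cont.
  assert (E2 : Rabs (Int (fun t => y2 t * A t)) <= 2 * PI * (c2 * (s * (PI / 2)))).
  { apply Int_abs_le; auto with cont. intros t _. rewrite Rabs_mult.
    apply Rmult_le_compat; auto using Rabs_pos. }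
  assert (E3 : forall t, Rabs (y1 t * A t) <= c1 * (s * (PI / 2))).
  { intros t. rewrite Rabs_mult. apply Rmult_le_compat; auto using Rabs_pos. }
  pose proof (E3 PI) as E4. pose proof (E3 (- PI)) as E5.
  apply Rabs_le_between in E2, E4, E5. nra.
Qed.

(** The weight [W] will be |R_K|^2, which has no sup bound uniform in K. It is therefore dominated
    by a bounded [W0] from a fixed truncation and a remainder [W1] that is small only in
    integral. *)
Lemma Int_derivative_weighted_le (y y1 y2 W W0 W1 : R -> R) s c1 c2 B : 0 < s ->
  (forall t, is_derive y t (y1 t)) -> (forall t, is_derive y1 t (y2 t)) -> cont y2 ->
  (forall t, Rabs (y1 t) <= c1) -> (forall t, Rabs (y2 t) <= c2) ->
  cont W -> cont W1 -> (forall t, 0 <= W t) -> (forall t, 0 <= W0 t <= B) ->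
  (forall t, 0 <= W1 t) -> (forall t, W t <= 2 * W0 t + 2 * W1 t) ->
  Int (fun t => y1 t ^ 2 * W t) <=
    c1 ^ 2 / s ^ 2 * Int (fun t => y t ^ 2 * W t)
    + 2 * B * (s * (PI * c1 + PI ^ 2 * c2)) + 2 * c1 ^ 2 * Int W1.
Proof.
  intros Hs Hy Hy1 Cy2 B1 B2 CW CW1 PW PW0 PW1 HW.
  assert (Cy : cont y) by (eapply cont_derive; eauto).
  assert (Cy1 : cont y1) by (eapply cont_derive; eauto).
  destruct (Int_derivative_concentration y y1 y2 s c1 c2) as [Cq Hq]; auto.
  assert (HB : 0 <= B) by (specialize (PW0 0); lra).
  apply Rle_trans with (c1 ^ 2 / s ^ 2 * Int (fun t => y t ^ 2 * W t)
    + 2 * B * Int (fun t => y1 t ^ 2 * / (1 + (y t / s) ^ 2)) + 2 * c1 ^ 2 * Int W1);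
    [|nra].
  rewrite <- !Int_scal by auto with cont.
  rewrite <- !Int_plus by auto 10 with cont.
  apply Int_le; auto 10 with cont. intros t _.
  assert (Hy1t : y1 t ^ 2 <= c1 ^ 2).
  { rewrite <- pow2_abs. apply pow_incr. split; [apply Rabs_pos|auto]. }
  set (z := (y t / s) ^ 2). assert (Hz : 0 <= z) by apply pow2_ge_0.
  replace (c1 ^ 2 / s ^ 2 * (y t ^ 2 * W t)) with (c1 ^ 2 * (z * W t)) by (unfold z; field; lra).
  set (q := / (1 + z)).
  assert (Hq1 : 0 < q <= 1).
  { unfold q. split; [apply Rinv_0_lt_compat; lra|]. rewrite <- Rinv_1. apply Rinv_le_contravar; lra. }
  assert (Hq2 : 1 - q <= z).
  { assert (q * (1 + z) = 1) by (unfold q; field; lra). nra. }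
  pose proof (pow2_ge_0 (y1 t)) as P1. set (Y := y1 t ^ 2) in *. set (D := c1 ^ 2) in *.
  specialize (PW t). specialize (PW0 t). specialize (PW1 t). specialize (HW t).
  (* Split W as (1 - q) W + q W. The first part is paid by y^2 W, because 1 - q <= (y/s)^2; in the
     second, [W0] meets the concentration estimate and [W1] is bounded crudely. *)
  assert (F1 : Y * ((1 - q) * W t) <= D * (z * W t)).
  { apply Rmult_le_compat; auto; try nra. }
  assert (F2 : (Y * q) * W t <= (Y * q) * (2 * B + 2 * W1 t)).
  { apply Rmult_le_compat_l; nra. }
  assert (F3 : Y * q * W1 t <= D * W1 t).
  { apply Rmult_le_compat_r; auto. nra. }
  nra.
Qed.

(** * Annihilation in mean square *)

Lemma small_factor C eps : 0 < eps -> exists eta, 0 < eta /\ C * eta <= eps.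
Proof.
  intros H. exists (eps / (Rabs C + 1)). pose proof (Rabs_pos C). pose proof (Rle_abs C).
  assert (0 < eps / (Rabs C + 1)) by (apply Rdiv_lt_0_compat; lra).
  split; auto. replace eps with ((Rabs C + 1) * (eps / (Rabs C + 1))) at 2 by (field; lra). nra.
Qed.

(* In terms of the limits f = sum b_k e^{ikt} and phi = sum r_k e^{ikt} this says f * phi = 0
   in L^2. Keeping both factors truncated avoids integrating anything but trigonometric polynomials. *)
Definition annihilates (b r : Z -> R) : Prop :=
  forall eps, 0 < eps -> exists K0, forall K, (K0 <= K)%nat ->
    exists N0, forall N, (N0 <= N)%nat -> Int (fun t => Nrm b N t * Nrm r K t) <= eps.

Lemma annihilates_scal c b r : annihilates b r -> annihilates (fun k => c * b k) r.
Proof.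
  intros H eps He. destruct (small_factor (c ^ 2) eps He) as (eta & Heta & Hc).
  destruct (H eta Heta) as [K0 HK]. exists K0; intros K Hk.
  destruct (HK K Hk) as [N0 HN]. exists N0; intros N Hn.
  rewrite (Int_ext _ (fun t => c ^ 2 * (Nrm b N t * Nrm r K t)))
    by (intros; rewrite Nrm_scal; ring).
  rewrite Int_scal by auto with cont. pose proof (HN N Hn). pose proof (pow2_ge_0 c). nra.
Qed.

Lemma annihilates_plus b b' r :
  annihilates b r -> annihilates b' r -> annihilates (fun k => b k + b' k) r.
Proof.
  intros H H' eps He.
  destruct (H (eps / 4) ltac:(lra)) as [K0 HK]. destruct (H' (eps / 4) ltac:(lra)) as [K0' HK'].
  exists (max K0 K0'); intros K Hk.
  destruct (HK K ltac:(lia)) as [N0 HN]. destruct (HK' K ltac:(lia)) as [N0' HN'].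
  exists (max N0 N0'); intros N Hn.
  specialize (HN N ltac:(lia)). specialize (HN' N ltac:(lia)).
  apply Rle_trans with (2 * Int (fun t => Nrm b N t * Nrm r K t) + 2 * Int (fun t => Nrm b' N t * Nrm r K t)); [|lra].
  rewrite <- !Int_scal, <- Int_plus by auto with cont.
  apply Int_le; auto 10 with cont. intros t _.
  pose proof (Nrm_plus_le b b' N t). pose proof (Nrm_nonneg r K t). nra.
Qed.

(** The l^1 distance of b and b' bounds the sup distance of their trigonometric polynomials,
    uniformly in N, while the mean square of R_K stays bounded by Parseval. *)
Lemma annihilates_limit b r M : (forall N, ZsumR (fun k => r k ^ 2) N <= M) ->
  (forall eta, 0 < eta -> exists b', annihilates b' r /\
     forall N, ZsumR (fun k => Rabs (b k - b' k)) N <= eta) ->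
  annihilates b r.
Proof.
  intros HM H eps He.
  destruct (small_factor (8 * PI * M) (eps / 2) ltac:(lra)) as (eta & Heta & Hc).
  (* The error enters squared; capping it at 1 gives e^2 <= eta. *)
  destruct (H (Rmin 1 eta) ltac:(apply Rmin_glb_lt; lra)) as (b' & Hb' & Hd).
  assert (Hm : 0 < Rmin 1 eta) by (apply Rmin_glb_lt; lra).
  pose proof (Rmin_l 1 eta) as Hm1. pose proof (Rmin_r 1 eta) as Hm2. set (e := Rmin 1 eta) in *.
  assert (M0 : 0 <= M).
  { eapply Rle_trans; [|apply (HM 0%nat)]. apply ZsumR_nonneg; intros; apply pow2_ge_0. }
  destruct (Hb' (eps / 4) ltac:(lra)) as [K0 HK]. exists K0; intros K Hk.
  destruct (HK K Hk) as [N0 HN]. exists N0; intros N Hn. specialize (HN N Hn).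
  apply Rle_trans with (2 * Int (fun t => Nrm b' N t * Nrm r K t) + 4 * e ^ 2 * Int (Nrm r K)).
  - rewrite <- !Int_scal, <- Int_plus by auto with cont.
    apply Int_le; auto 10 with cont. intros t _.
    rewrite (Nrm_ext b (fun k => b' k + (b k - b' k))) by (intros; ring).
    pose proof (Nrm_plus_le b' (fun k => b k - b' k) N t).
    pose proof (Nrm_le (fun k => b k - b' k) N t e (Hd N)).
    pose proof (Nrm_nonneg r K t). nra.
  - rewrite Int_Nrm. specialize (HM K).
    assert (Q0 : 0 <= ZsumR (fun k => r k ^ 2) K) by (apply ZsumR_nonneg; intros; apply pow2_ge_0).
    set (Q := ZsumR (fun k => r k ^ 2) K) in *. pose proof PI_RGT_0 as HPI.
    assert (e ^ 2 <= eta) by nra.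
    assert (4 * e ^ 2 * (2 * PI * Q) <= 8 * PI * M * eta).
    { replace (4 * e ^ 2 * (2 * PI * Q)) with (8 * PI * (Q * e ^ 2)) by ring.
      replace (8 * PI * M * eta) with (8 * PI * (M * eta)) by ring.
      apply Rmult_le_compat_l; [lra|]. apply Rmult_le_compat; auto. apply pow2_ge_0. }
    lra.
Qed.

(** A class stable under [kmul], which has to be iterated arbitrarily often, and giving bounds on
    derivatives uniform in the truncation. *)
Definition rapid (b : Z -> R) : Prop :=
  forall j, summable (fun k => IZR k ^ j * b k).

Lemma rapid_summable b : rapid b -> summable b.
Proof.
  intros H. destruct (H 0%nat) as [M HM]. exists M; intros N.
  eapply Rle_trans; [|apply (HM N)]. apply ZsumR_le; intros. simpl. rewrite Rmult_1_l; lra.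
Qed.

Lemma rapid_kmul b : rapid b -> rapid (kmul b).
Proof.
  intros H j. destruct (H (S j)) as [M HM]. exists M; intros N.
  eapply Rle_trans; [|apply (HM N)]. apply ZsumR_le; intros. unfold kmul. simpl.
  right; f_equal; ring.
Qed.

Lemma rapid_lin b b' c : rapid b -> rapid b' -> rapid (fun k => b k + c * b' k).
Proof.
  intros H H' j. destruct (H j) as [M HM]. destruct (H' j) as [M' HM'].
  exists (M + Rabs c * M'); intros N.
  specialize (HM N); specialize (HM' N). pose proof (Rabs_pos c).
  eapply Rle_trans with (ZsumR (fun k => Rabs (IZR k ^ j * b k) + Rabs c * Rabs (IZR k ^ j * b' k)) N).
  - apply ZsumR_le; intros k. rewrite <- Rabs_mult. eapply Rle_trans; [|apply Rabs_triang].
    right; f_equal; ring.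
  - rewrite ZsumR_plus, ZsumR_scal. nra.
Qed.

Lemma annihilates_kmul b r M : rapid b -> (forall N, ZsumR (fun k => r k ^ 2) N <= M) ->
  annihilates b r -> annihilates (kmul b) r.
Proof.
  intros Hb HM H eps He.
  destruct (rapid_summable _ (rapid_kmul _ Hb)) as [c1 Hc1].
  destruct (rapid_summable _ (rapid_kmul _ (rapid_kmul _ Hb))) as [c2 Hc2].
  (* The order of choices matters: K1 makes the tail of r small, s is taken small against the sup
     bound B of the head cut at K1, and e is taken small against c1^2 / s^2. Factors 4 instead of 2
     account for adding the estimates for real and imaginary parts. *)
  destruct (small_factor (4 * c1 ^ 2 * (2 * PI)) (eps / 3) ltac:(lra)) as (eta & Heta & Heta').
  destruct (ZsumR_tail (fun k => r k ^ 2) M (fun k => pow2_ge_0 _) HM eta Heta) as [K1 HK1].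
  set (B := 2 * ZsumR (fun k => Rabs (r k)) K1 ^ 2).
  destruct (small_factor (4 * B * (PI * c1 + PI ^ 2 * c2)) (eps / 3) ltac:(lra)) as (s & Hs & Hs').
  destruct (small_factor (c1 ^ 2 / s ^ 2) (eps / 3) ltac:(lra)) as (e & Hpos & He').
  destruct (H e Hpos) as [K2 HK2]. exists (max K1 K2); intros K HK.
  destruct (HK2 K ltac:(lia)) as [N0 HN0]. exists N0; intros N HN. specialize (HN0 N HN).
  assert (HB : forall t, 0 <= Nrm r K1 t <= B).
  { intros t; split; [apply Nrm_nonneg|]. unfold B. apply Nrm_le; lra. }
  assert (EC := Int_derivative_weighted_le (Cs b N) (fun t => - Sn (kmul b) N t)
     (fun t => - Cs (kmul (kmul b)) N t) (Nrm r K) (Nrm r K1) (Nrm (tail r K1) K) s c1 c2 B Hs).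
  assert (ES := Int_derivative_weighted_le (Sn b N) (Cs (kmul b) N)
     (fun t => - Sn (kmul (kmul b)) N t) (Nrm r K) (Nrm r K1) (Nrm (tail r K1) K) s c1 c2 B Hs).
  assert (CN : forall f, cont f -> cont (fun t => - f t)).
  { intros f Hf t. apply (continuous_opp f), Hf. }
  specialize (EC (is_derive_Cs b N)).
  specialize (ES (is_derive_Sn b N) (is_derive_Cs (kmul b) N)).
  assert (W1 : forall t, Nrm r K t <= 2 * Nrm r K1 t + 2 * Nrm (tail r K1) K t)
    by (intros; apply Nrm_tail_le; lia).
  assert (EC' := EC ltac:(intros t; apply (is_derive_opp (Sn (kmul b) N)), is_derive_Sn)
    ltac:(auto with cont)
    ltac:(intros t; cbv beta; rewrite Rabs_Ropp; eapply Rle_trans; [apply Sn_abs_le | apply Hc1])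
    ltac:(intros t; cbv beta; rewrite Rabs_Ropp; eapply Rle_trans; [apply Cs_abs_le | apply Hc2])
    (cont_Nrm _ _) (cont_Nrm _ _) (Nrm_nonneg _ _) HB (Nrm_nonneg _ _) W1).
  assert (ES' := ES ltac:(auto with cont)
    ltac:(intros t; eapply Rle_trans; [apply Cs_abs_le | apply Hc1])
    ltac:(intros t; cbv beta; rewrite Rabs_Ropp; eapply Rle_trans; [apply Sn_abs_le | apply Hc2])
    (cont_Nrm _ _) (cont_Nrm _ _) (Nrm_nonneg _ _) HB (Nrm_nonneg _ _) W1).
  clear EC ES. rewrite (Int_Nrm_tail r K1 K) in EC', ES' by lia.
  specialize (HK1 K1 K ltac:(lia)).
  rewrite (Int_ext _ (fun t => (- Sn (kmul b) N t) ^ 2 * Nrm r K t + Cs (kmul b) N t ^ 2 * Nrm r K t))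
    by (intros; unfold Nrm at 1; ring).
  rewrite (Int_ext (fun t => Nrm b N t * Nrm r K t) (fun t => Cs b N t ^ 2 * Nrm r K t + Sn b N t ^ 2 * Nrm r K t))
    in HN0 by (intros; unfold Nrm at 1; ring).
  rewrite Int_plus in HN0 by auto with cont. rewrite Int_plus by auto with cont.
  set (x1 := Int (fun t => (- Sn (kmul b) N t) ^ 2 * Nrm r K t)) in *.
  set (x2 := Int (fun t => Cs (kmul b) N t ^ 2 * Nrm r K t)) in *.
  set (x3 := Int (fun t => Cs b N t ^ 2 * Nrm r K t)) in *.
  set (x4 := Int (fun t => Sn b N t ^ 2 * Nrm r K t)) in *.
  set (q := ZsumR (fun k => r k ^ 2) K - ZsumR (fun k => r k ^ 2) K1) in *.
  assert (G1 : c1 ^ 2 / s ^ 2 * (x3 + x4) <= eps / 3).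
  { eapply Rle_trans; [|exact He']. apply Rmult_le_compat_l; auto.
    apply Rmult_le_pos; [apply pow2_ge_0|]. left; apply Rinv_0_lt_compat. nra. }
  assert (G2 : 4 * c1 ^ 2 * (2 * PI) * q <= eps / 3).
  { eapply Rle_trans; [|exact Heta']. apply Rmult_le_compat_l; auto.
    pose proof PI_RGT_0. pose proof (pow2_ge_0 c1). nra. }
  set (D := c1 ^ 2 / s ^ 2) in *. lra.
Qed.

(** * Products of trigonometric polynomials and convolution *)

Lemma Cs_Sn_prod_cos a r N K t :
  Cs a N t * Cs r K t - Sn a N t * Sn r K t =
  ZsumR (fun k => ZsumR (fun m => (a k * r m) * cos (IZR (k + m) * t)) K) N.
Proof.
  unfold Cs, Sn. rewrite <- !ZsumR_scal_r, <- ZsumR_minus. apply ZsumR_ext; intros k.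
  rewrite <- !ZsumR_scal, <- ZsumR_minus. apply ZsumR_ext; intros m.
  rewrite plus_IZR, Rmult_plus_distr_r, cos_plus. ring.
Qed.

Lemma Cs_Sn_prod_sin a r N K t :
  Cs a N t * Sn r K t + Sn a N t * Cs r K t =
  ZsumR (fun k => ZsumR (fun m => (a k * r m) * sin (IZR (k + m) * t)) K) N.
Proof.
  unfold Cs, Sn. rewrite <- !ZsumR_scal_r, <- ZsumR_plus. apply ZsumR_ext; intros k.
  rewrite <- !ZsumR_scal, <- ZsumR_plus. apply ZsumR_ext; intros m.
  rewrite plus_IZR, Rmult_plus_distr_r, sin_plus. ring.
Qed.

(** The integrand is the real part of e^{-ilt} f_N R_K, so this extracts the l-th Fourier
    coefficient, a truncated convolution. *)
Lemma Int_product_coefficient a r N K l :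
  Int (fun t => cos (IZR l * t) * (Cs a N t * Cs r K t - Sn a N t * Sn r K t)
              + sin (IZR l * t) * (Cs a N t * Sn r K t + Sn a N t * Cs r K t)) =
  2 * PI * ZsumR (fun p => trunc a N (l - p) * r p) K.
Proof.
  rewrite (Int_ext _ (fun t => ZsumR (fun k => ZsumR (fun m =>
              (a k * r m) * cos (IZR (k + m - l) * t)) K) N)).
  - rewrite Int_ZsumR by auto with cont.
    rewrite (ZsumR_ext _ (fun k => ZsumR (fun m => if (k =? l - m)%Z then 2 * PI * (a k * r m) else 0) K)).
    + rewrite ZsumR_swap, <- ZsumR_scal. apply ZsumR_ext; intros m.
      rewrite ZsumR_delta. unfold trunc. destruct (Z.abs (l - m) <=? Z.of_nat N)%Z; ring.
    + intros k. rewrite Int_ZsumR by auto with cont. apply ZsumR_ext; intros m.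
      rewrite Int_scal, Int_cos by auto with cont.
      destruct (Z.eqb_spec (k + m - l) 0); destruct (Z.eqb_spec k (l - m)); try lia; ring.
  - intros t. rewrite Cs_Sn_prod_cos, Cs_Sn_prod_sin, <- !ZsumR_scal, <- ZsumR_plus.
    apply ZsumR_ext; intros k. rewrite <- !ZsumR_scal, <- ZsumR_plus. apply ZsumR_ext; intros m.
    rewrite (minus_IZR (k + m)), Rmult_minus_distr_r, cos_minus. ring.
Qed.

(** The integrand is the real part of f_N R_K times the conjugate of f_N R_K'. Expanding only the
    first factor exposes the Fourier coefficients of the second. *)
Lemma Int_cross a r N K K' :
  Int (fun t => Nrm a N t * (Cs r K t * Cs r K' t + Sn r K t * Sn r K' t)) =
  ZsumR (fun k => ZsumR (fun m => (a k * r m) *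
     (2 * PI * ZsumR (fun p => trunc a N (k + m - p) * r p) K')) K) N.
Proof.
  set (U := fun t => Cs a N t * Cs r K' t - Sn a N t * Sn r K' t).
  set (V := fun t => Cs a N t * Sn r K' t + Sn a N t * Cs r K' t).
  assert (CU : cont U) by (unfold U; auto with cont).
  assert (CV : cont V) by (unfold V; auto with cont).
  rewrite (Int_ext _ (fun t => ZsumR (fun k => ZsumR (fun m =>
    (a k * r m) * (cos (IZR (k + m) * t) * U t + sin (IZR (k + m) * t) * V t)) K) N)).
  - rewrite Int_ZsumR by auto 10 with cont. apply ZsumR_ext; intros k.
    rewrite Int_ZsumR by auto 10 with cont. apply ZsumR_ext; intros m.
    rewrite Int_scal by auto with cont. f_equal. apply Int_product_coefficient.
  - intros t. transitivity ((Cs a N t * Cs r K t - Sn a N t * Sn r K t) * U t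
                          + (Cs a N t * Sn r K t + Sn a N t * Cs r K t) * V t).
    { unfold U, V, Nrm. ring. }
    rewrite Cs_Sn_prod_cos, Cs_Sn_prod_sin, <- !ZsumR_scal_r, <- ZsumR_plus.
    apply ZsumR_ext; intros k. rewrite <- !ZsumR_scal_r, <- ZsumR_plus.
    apply ZsumR_ext; intros m. ring.
Qed.

Lemma Un_cv_uniform_list (u : Z -> nat -> R) (L : list Z) :
  (forall l, Un_cv (u l) 0) -> forall eps, 0 < eps ->
  exists n0, forall n, (n0 <= n)%nat -> forall l, In l L -> Rabs (u l n) <= eps.
Proof.
  intros H eps He. induction L as [|x L [n0 IH]].
  - exists 0%nat. intros n _ l [].
  - destruct (H x eps He) as [n1 H1]. exists (max n0 n1). intros n Hn l [<-|Hl].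
    + specialize (H1 n ltac:(lia)). unfold Rdist in H1. rewrite Rminus_0_r in H1. lra.
    + apply IH; auto; lia.
Qed.

(* Pairing f_N R_K with f_N R_{K'}: the difference is controlled by the l^2 tail of r, and
   the Fourier coefficients of f_N R_{K'} tend to those of a * r, which vanish. *)
Lemma convolution_zero_annihilates a r M : summable a ->
  (forall N, ZsumR (fun k => r k ^ 2) N <= M) ->
  (forall l, Un_cv (ZsumR (fun p => a (l - p)%Z * r p)) 0) ->
  annihilates a r.
Proof.
  intros [A HA] HM Hconv eps He.
  assert (M0 : 0 <= M).
  { eapply Rle_trans; [|apply (HM 0%nat)]. apply ZsumR_nonneg; intros; apply pow2_ge_0. }
  assert (A0 : 0 <= A).
  { eapply Rle_trans; [|apply (HA 0%nat)]. apply ZsumR_nonneg; intros; apply Rabs_pos. }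
  (* From x^2 <= M follows x <= M + 1, which avoids a square root. *)
  assert (Hr : forall k, Rabs (r k) <= M + 1).
  { intros k. pose proof (ZsumR_ge_term (fun k => r k ^ 2) (Z.abs_nat k) k (fun _ => pow2_ge_0 _) ltac:(lia)) as Hk.
    specialize (HM (Z.abs_nat k)). cbv beta in Hk. rewrite <- pow2_abs in Hk.
    pose proof (Rabs_pos (r k)). nra. }
  pose proof PI_RGT_0 as HPI.
  destruct (small_factor (2 * A ^ 2 * (2 * PI) * (M + 1)) (eps / 2) ltac:(lra)) as (eta & Heta & Heta').
  (* The tail is taken below eta^2 because it will be divided by eta in the AM-GM step. *)
  destruct (ZsumR_tail (fun k => r k ^ 2) M (fun k => pow2_ge_0 _) HM (eta ^ 2) ltac:(nra)) as [K0 HK0].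
  exists K0; intros K HK.
  set (R1 := ZsumR (fun k => Rabs (r k)) K).
  assert (R10 : 0 <= R1) by (apply ZsumR_nonneg; intros; apply Rabs_pos).
  destruct (small_factor (A * R1 * (2 * PI) * (M + 2)) (eps / 2) ltac:(lra)) as (e & Hpos & He').
  destruct (ZsumR_tail (fun k => Rabs (a k)) A (fun k => Rabs_pos _) HA e Hpos) as [N0 HN0].
  exists N0; intros N HN.
  destruct (Un_cv_uniform_list (fun l => ZsumR (fun p => a (l - p)%Z * r p)) (Zrange (N + K)) Hconv e Hpos)
    as [K1 HK1].
  set (K' := (K1 + K + N)%nat).
  (* The convolution sum itself contributes e, uniformly over the finitely many frequencies of f_N
     R_K, and cutting a at N contributes (M + 1) e. *)
  assert (Hcoef : forall l, (Z.abs l <= Z.of_nat (N + K))%Z ->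
     Rabs (ZsumR (fun p => trunc a N (l - p) * r p) K') <= (M + 2) * e).
  { intros l Hl.
    replace (ZsumR (fun p => trunc a N (l - p) * r p) K')
      with (ZsumR (fun p => a (l - p)%Z * r p) K' - ZsumR (fun p => tail a N (l - p) * r p) K').
    2:{ rewrite <- ZsumR_minus. apply ZsumR_ext; intros p. unfold trunc, tail.
        destruct (Z.abs (l - p) <=? Z.of_nat N)%Z; ring. }
    assert (H1 := HK1 K' ltac:(unfold K'; lia) l (proj2 (in_Zrange _ _) Hl)). cbv beta in H1.
    assert (H2 : Rabs (ZsumR (fun p => tail a N (l - p) * r p) K') <= (M + 1) * e).
    { eapply Rle_trans; [apply ZsumR_abs|].
      apply Rle_trans with (ZsumR (fun p => (M + 1) * Rabs (tail a N (l - p))) K').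
      - apply ZsumR_le; intros p. rewrite Rabs_mult, Rmult_comm.
        apply Rmult_le_compat_r; auto using Rabs_pos.
      - rewrite ZsumR_scal. apply Rmult_le_compat_l; [lra|].
        eapply Rle_trans; [apply (ZsumR_shift_le (fun p => Rabs (tail a N p))); intros; apply Rabs_pos|].
        rewrite (ZsumR_ext _ (fun k => if (Z.abs k <=? Z.of_nat N)%Z then 0 else Rabs (a k))).
        + rewrite ZsumR_outside by (unfold K'; lia). apply HN0; unfold K'; lia.
        + intros k. unfold tail. destruct (Z.abs k <=? Z.of_nat N)%Z; auto using Rabs_R0. }
    apply Rabs_le_between in H1, H2. apply Rabs_le. lra. }
  assert (Hcross : Rabs (Int (fun t => Nrm a N t * (Cs r K t * Cs r K' t + Sn r K t * Sn r K' t))) <= eps / 2).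
  { rewrite Int_cross. eapply Rle_trans; [apply ZsumR_abs|].
    apply Rle_trans with (ZsumR (fun k => ZsumR (fun m => (Rabs (a k) * Rabs (r m)) * (2 * PI * ((M + 2) * e))) K) N).
    - apply ZsumR_le_in; intros k Hk. eapply Rle_trans; [apply ZsumR_abs|].
      apply ZsumR_le_in; intros m Hm. rewrite !Rabs_mult.
      assert (0 <= Rabs (a k) * Rabs (r m)) by (apply Rmult_le_pos; apply Rabs_pos).
      apply Rmult_le_compat_l; auto.
      rewrite (Rabs_right 2), (Rabs_right PI) by lra.
      apply Rmult_le_compat_l; [lra|]. apply Hcoef. lia.
    - rewrite (ZsumR_ext _ (fun k => Rabs (a k) * (R1 * (2 * PI * ((M + 2) * e))))).
      + rewrite ZsumR_scal_r. specialize (HA N).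
        eapply Rle_trans; [|exact He'].
        replace (A * R1 * (2 * PI) * (M + 2) * e) with (A * (R1 * (2 * PI * ((M + 2) * e)))) by ring.
        apply Rmult_le_compat_r; auto.
        apply Rmult_le_pos; [lra|]. apply Rmult_le_pos; [lra|]. apply Rmult_le_pos; lra.
      + intros k. rewrite ZsumR_scal_r. unfold R1. rewrite ZsumR_scal. ring. }
  set (W := Nrm r K). set (W1 := Nrm (tail r K) K').
  (* Replacing R_K' by R_K costs |f_N|^2 times P, the real part of R_K paired with R_K' - R_K. As
     |f_N|^2 <= 2 A^2 and -P is at most half the AM-GM bound, the factor A^2 remains. *)
  assert (Hdiff : Int (fun t => Nrm a N t * Nrm r K t) <=
     Int (fun t => Nrm a N t * (Cs r K t * Cs r K' t + Sn r K t * Sn r K' t))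
     + A ^ 2 * (eta * Int W + / eta * Int W1)).
  { rewrite <- (Int_scal eta), <- (Int_scal (/ eta)), <- Int_plus, <- Int_scal, <- Int_plus
      by (unfold W, W1; auto 10 with cont).
    apply Int_le; unfold W, W1; auto 15 with cont. intros t _.
    assert (Ha : Nrm a N t <= 2 * A ^ 2) by (apply Nrm_le; auto).
    pose proof (Nrm_nonneg a N t) as Ha0.
    set (P := Cs r K t * Cs (tail r K) K' t + Sn r K t * Sn (tail r K) K' t).
    assert (EP : Cs r K t * Cs r K' t + Sn r K t * Sn r K' t = Nrm r K t + P).
    { unfold P, Nrm. rewrite Cs_tail, Sn_tail by (unfold K'; lia). ring. }
    rewrite EP.
    assert (Hie : eta * / eta = 1) by (field; lra).
    assert (0 < / eta) by (apply Rinv_0_lt_compat; lra).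
    (* AM-GM: -2 P <= eta |R_K|^2 + |R_K' - R_K|^2 / eta *)
    assert (HP : - (2 * P) <= eta * Nrm r K t + / eta * Nrm (tail r K) K' t).
    { unfold P, Nrm.
      set (x1 := Cs r K t); set (x2 := Sn r K t).
      set (y1 := Cs (tail r K) K' t); set (y2 := Sn (tail r K) K' t).
      assert (S1 : 0 <= / eta * (eta * x1 + y1) ^ 2) by (apply Rmult_le_pos; [lra|apply pow2_ge_0]).
      assert (S2 : 0 <= / eta * (eta * x2 + y2) ^ 2) by (apply Rmult_le_pos; [lra|apply pow2_ge_0]).
      replace (/ eta * (eta * x1 + y1) ^ 2) with (eta * x1 ^ 2 + 2 * (x1 * y1) + / eta * y1 ^ 2) in S1 by (field; lra).
      replace (/ eta * (eta * x2 + y2) ^ 2) with (eta * x2 ^ 2 + 2 * (x2 * y2) + / eta * y2 ^ 2) in S2 by (field; lra).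
      lra. }
    set (Z0 := eta * Nrm r K t + / eta * Nrm (tail r K) K' t) in *.
    assert (0 <= Z0).
    { unfold Z0. pose proof (Nrm_nonneg r K t). pose proof (Nrm_nonneg (tail r K) K' t). nra. }
    nra. }
  assert (HW : Int W <= 2 * PI * M).
  { unfold W. rewrite Int_Nrm. apply Rmult_le_compat_l; [lra|auto]. }
  assert (HW1 : / eta * Int W1 <= 2 * PI * eta).
  { unfold W1. rewrite Int_Nrm_tail by (unfold K'; lia).
    specialize (HK0 K K' ltac:(unfold K'; lia)).
    apply Rmult_le_reg_l with eta; auto. rewrite <- Rmult_assoc, Rinv_r by lra.
    set (q := ZsumR _ K' - _) in *. nra. }
  assert (HA2 : A ^ 2 * (eta * Int W + / eta * Int W1) <= eps / 2).
  { apply Rle_trans with (A ^ 2 * (eta * (2 * PI * M) + 2 * PI * eta)).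
    - apply Rmult_le_compat_l; [apply pow2_ge_0|].
      apply Rplus_le_compat; auto. apply Rmult_le_compat_l; lra.
    - assert (0 <= A ^ 2 * (2 * PI) * (M + 1) * eta).
      { apply Rmult_le_pos; [|lra]. apply Rmult_le_pos; [|lra].
        apply Rmult_le_pos; [apply pow2_ge_0|lra]. }
      lra. }
  apply Rabs_le_between in Hcross. unfold W in *. lra.
Qed.

(** * Exponential weights and interpolation at the integers *)

Lemma exp_partial_sum_le x n : 0 <= x -> sum_f_R0 (fun i => / INR (fact i) * x ^ i) n <= exp x.
Proof.
  intros Hx. unfold exp. destruct (exist_exp x) as [l Hl]; simpl.
  apply sum_incr; [exact Hl|]. intros i.
  apply Rmult_le_pos; [left; apply Rinv_0_lt_compat, INR_fact_lt_0 | now apply pow_le].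
Qed.

Lemma pow_div_fact_le_exp x n : 0 <= x -> x ^ n / INR (fact n) <= exp x.
Proof.
  intros Hx. eapply Rle_trans; [|apply (exp_partial_sum_le x n Hx)].
  assert (H : forall i, 0 <= / INR (fact i) * x ^ i).
  { intros i. apply Rmult_le_pos; [left; apply Rinv_0_lt_compat, INR_fact_lt_0 | now apply pow_le]. }
  unfold Rdiv. rewrite Rmult_comm. destruct n; cbn [sum_f_R0]; [lra|].
  pose proof (cond_pos_sum _ n H). lra.
Qed.

Lemma exp_INR_le n : exp (INR n) <= 3 ^ n.
Proof.
  induction n; [simpl; rewrite exp_0; lra|].
  rewrite S_INR, exp_plus. simpl. pose proof exp_le_3. pose proof (exp_pos (INR n)).
  pose proof (exp_pos 1). nra.
Qed.

Lemma INR_pow_le j m : INR m ^ j <= INR (fact j) * 3 ^ m.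
Proof.
  pose proof (pow_div_fact_le_exp (INR m) j (pos_INR m)). pose proof (exp_INR_le m).
  pose proof (INR_fact_lt_0 j).
  replace (INR m ^ j) with (INR (fact j) * (INR m ^ j / INR (fact j))) by (field; lra).
  apply Rmult_le_compat_l; lra.
Qed.

Lemma IZR_abs_INR k : Rabs (IZR k) = INR (Z.abs_nat k).
Proof. rewrite INR_IZR_INZ, <- abs_IZR. f_equal. lia. Qed.

Lemma rapid_of_exponential a A :
  (forall N, ZsumR (fun k => Rabs (a k) * 9 ^ Z.abs_nat k) N <= A) -> rapid a.
Proof.
  intros HA j. exists (INR (fact j) * A). intros N.
  apply Rle_trans with (ZsumR (fun k => INR (fact j) * (Rabs (a k) * 9 ^ Z.abs_nat k)) N).
  - apply ZsumR_le; intros k. rewrite Rabs_mult, <- RPow_abs, IZR_abs_INR.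
    pose proof (INR_pow_le j (Z.abs_nat k)) as H. pose proof (Rabs_pos (a k)).
    assert (3 ^ Z.abs_nat k <= 9 ^ Z.abs_nat k) by (apply pow_incr; lra).
    pose proof (INR_fact_lt_0 j).
    apply Rle_trans with (INR (fact j) * 9 ^ Z.abs_nat k * Rabs (a k)); [|lra].
    apply Rmult_le_compat_r; auto. eapply Rle_trans; [exact H|]. apply Rmult_le_compat_l; lra.
  - rewrite ZsumR_scal. apply Rmult_le_compat_l; [|apply HA]. left; apply INR_fact_lt_0.
Qed.

(* Truncation of the Euler product of sin (pi x) / (pi x): at integers within distance n of k0
   it equals the Kronecker delta at k0. *)
Fixpoint sinc_prod (k0 : Z) (n : nat) (k : Z) : R :=
  match n with
  | O => 1
  | S n' => sinc_prod k0 n' k * (1 - (IZR (k - k0) / INR n) ^ 2)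
  end.

Lemma sinc_prod_center k0 n : sinc_prod k0 n k0 = 1.
Proof.
  induction n; [reflexivity|]. cbn [sinc_prod]. rewrite IHn, Z.sub_diag.
  unfold Rdiv. rewrite Rmult_0_l. ring.
Qed.

Lemma sinc_prod_zero k0 n k : (1 <= Z.abs (k - k0) <= Z.of_nat n)%Z -> sinc_prod k0 n k = 0.
Proof.
  induction n; intros H; [lia|]. cbn [sinc_prod].
  destruct (Z.eq_dec (Z.abs (k - k0)) (Z.of_nat (S n))) as [E|].
  - replace ((IZR (k - k0) / INR (S n)) ^ 2) with 1; [ring|].
    rewrite <- pow2_abs, Rabs_div, IZR_abs_INR by (apply not_0_INR; lia).
    rewrite (Rabs_right (INR (S n))) by (apply Rle_ge, pos_INR).
    replace (Z.abs_nat (k - k0)) with (S n) by lia. field. apply not_0_INR; lia.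
  - rewrite IHn by lia. ring.
Qed.

(** With m = |k - k0| >= n, the i-th factor has modulus (m/i)^2 - 1 <= (m/i)^2, so the product is at
    most (m^n / n!)^2 <= e^{2m} <= 9^m. This is the origin of the weight 9. *)
Lemma sinc_prod_le k0 n k : (Z.of_nat n <= Z.abs (k - k0))%Z ->
  Rabs (sinc_prod k0 n k) <= 9 ^ Z.abs_nat (k - k0).
Proof.
  set (m := Z.abs_nat (k - k0)). intros H.
  assert (G : Rabs (sinc_prod k0 n k) <= (INR m ^ n / INR (fact n)) ^ 2).
  { induction n.
    - simpl. rewrite Rabs_R1. lra.
    - specialize (IHn ltac:(lia)). cbn [sinc_prod]. rewrite Rabs_mult.
      assert (Hn : 0 < INR (S n)) by (apply lt_0_INR; lia).
      assert (Hf := INR_fact_lt_0 n).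
      replace ((INR m ^ S n / INR (fact (S n))) ^ 2)
        with ((INR m ^ n / INR (fact n)) ^ 2 * (INR m / INR (S n)) ^ 2)
        by (rewrite fact_simpl, mult_INR; cbn [pow]; field; lra).
      apply Rmult_le_compat; auto using Rabs_pos.
      replace ((IZR (k - k0) / INR (S n)) ^ 2) with ((INR m / INR (S n)) ^ 2).
      + assert (Hm : INR (S n) <= INR m) by (apply le_INR; lia).
        assert (1 <= INR m / INR (S n)) by (apply Rmult_le_reg_r with (INR (S n)); auto; field_simplify; lra).
        rewrite Rabs_left1; nra.
      + unfold m. rewrite <- IZR_abs_INR, <- (Rabs_right (INR (S n))), <- Rabs_div, pow2_abs by lra.
        rewrite (Rabs_right (INR (S n))) by lra. reflexivity. }
  eapply Rle_trans; [exact G|].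
  replace 9 with (3 ^ 2) by ring. rewrite <- pow_mult, Nat.mul_comm, pow_mult.
  apply pow_incr. pose proof (INR_fact_lt_0 n). split.
  - apply Rmult_le_pos; [apply pow_le, pos_INR | left; now apply Rinv_0_lt_compat].
  - pose proof (pow_div_fact_le_exp (INR m) n (pos_INR m)). pose proof (exp_INR_le m). lra.
Qed.

(** Each new factor is b minus a multiple of (k - k0)^2 b, and multiplication by k - k0 is [kmul]
    minus the scalar k0; both properties survive these operations. *)
Lemma sinc_prod_annihilates a r M k0 n : rapid a -> annihilates a r ->
  (forall N, ZsumR (fun k => r k ^ 2) N <= M) ->
  rapid (fun k => sinc_prod k0 n k * a k) /\ annihilates (fun k => sinc_prod k0 n k * a k) r.
Proof.
  intros Ha Hr HM. induction n as [|n [IHa IHr]].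
  - replace (fun k => sinc_prod k0 0 k * a k) with a; auto.
    apply functional_extensionality; intros; simpl; ring.
  - set (b := fun k => sinc_prod k0 n k * a k) in *.
    assert (Hshift : forall b, rapid b -> annihilates b r ->
      rapid (fun k => kmul b k + - IZR k0 * b k) /\ annihilates (fun k => kmul b k + - IZR k0 * b k) r).
    { intros b0 H1 H2. split.
      - apply rapid_lin; auto using rapid_kmul.
      - apply annihilates_plus; [apply (annihilates_kmul _ _ M)|apply annihilates_scal]; auto. }
    destruct (Hshift b IHa IHr) as [H1 H2]. destruct (Hshift _ H1 H2) as [H3 H4].
    match type of H3 with rapid ?f => set (b2 := f) in * end.
    replace (fun k => sinc_prod k0 (S n) k * a k) with (fun k => b k + - (/ INR (S n)) ^ 2 * b2 k).
    + split; [apply rapid_lin | apply annihilates_plus; [|apply annihilates_scal]]; auto.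
    + apply functional_extensionality; intros k. unfold b2, kmul, b. cbn [sinc_prod].
      rewrite minus_IZR. unfold Rdiv. ring.
Qed.

(** A single exponential has constant modulus |c|, so by Parseval the integral is 2 pi c^2 times the
    square sum of r, and one nonzero entry keeps it away from 0. *)
Lemma annihilates_delta_zero r k0 c : c <> 0 ->
  annihilates (fun k => if (k =? k0)%Z then c else 0) r -> forall m, r m = 0.
Proof.
  intros Hc H m. apply NNPP; intros Hm.
  pose proof PI_RGT_0 as HPI.
  assert (Hc2 : 0 < c ^ 2) by (apply pow2_gt_0; auto).
  assert (Hm2 : 0 < r m ^ 2) by (apply pow2_gt_0; auto).
  set (X := c ^ 2 * (2 * PI * r m ^ 2)).
  assert (HX : 0 < X) by (unfold X; apply Rmult_lt_0_compat; [|apply Rmult_lt_0_compat]; lra).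
  destruct (H (X / 2) ltac:(lra)) as [K0 HK].
  destruct (HK (K0 + Z.abs_nat m)%nat ltac:(lia)) as [N0 HN].
  specialize (HN (N0 + Z.abs_nat k0)%nat ltac:(lia)).
  rewrite (Int_ext _ (fun t => c ^ 2 * Nrm r (K0 + Z.abs_nat m) t)) in HN.
  - rewrite Int_scal, Int_Nrm in HN by auto with cont.
    pose proof (ZsumR_ge_term (fun k => r k ^ 2) (K0 + Z.abs_nat m) m (fun _ => pow2_ge_0 _) ltac:(lia)) as G.
    cbv beta in G.
    assert (X <= c ^ 2 * (2 * PI * ZsumR (fun k => r k ^ 2) (K0 + Z.abs_nat m))).
    { unfold X. apply Rmult_le_compat_l; [lra|]. apply Rmult_le_compat_l; lra. }
    lra.
  - intros t. f_equal. unfold Nrm.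
    replace (Cs (fun k => if (k =? k0)%Z then c else 0) (N0 + Z.abs_nat k0) t) with (c * cos (IZR k0 * t)).
    replace (Sn (fun k => if (k =? k0)%Z then c else 0) (N0 + Z.abs_nat k0) t) with (c * sin (IZR k0 * t)).
    + pose proof (sin2_cos2 (IZR k0 * t)) as E. unfold Rsqr in E.
      replace (c ^ 2) with (c ^ 2 * (sin (IZR k0 * t) * sin (IZR k0 * t) + cos (IZR k0 * t) * cos (IZR k0 * t)))
        by (rewrite E; ring). ring.
    + unfold Sn. rewrite (ZsumR_ext _ (fun k => if (k =? k0)%Z then c * sin (IZR k * t) else 0)).
      * rewrite ZsumR_delta. destruct (Z.leb_spec (Z.abs k0) (Z.of_nat (N0 + Z.abs_nat k0))); [easy|lia].
      * intros k. destruct (k =? k0)%Z; ring.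
    + unfold Cs. rewrite (ZsumR_ext _ (fun k => if (k =? k0)%Z then c * cos (IZR k * t) else 0)).
      * rewrite ZsumR_delta. destruct (Z.leb_spec (Z.abs k0) (Z.of_nat (N0 + Z.abs_nat k0))); [easy|lia].
      * intros k. destruct (k =? k0)%Z; ring.
Qed.

Lemma convolution_injective (a r : Z -> R) A M k0 :
  (forall N, ZsumR (fun k => Rabs (a k) * 9 ^ Z.abs_nat k) N <= A) -> a k0 <> 0 ->
  (forall N, ZsumR (fun k => r k ^ 2) N <= M) ->
  (forall l, Un_cv (ZsumR (fun p => a (l - p)%Z * r p)) 0) ->
  forall m, r m = 0.
Proof.
  intros HA Ha0 HM Hconv.
  assert (Ra := rapid_of_exponential a A HA).
  assert (Hr := convolution_zero_annihilates a r M (rapid_summable _ Ra) HM Hconv).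
  apply (annihilates_delta_zero r k0 (a k0) Ha0).
  apply (annihilates_limit _ r M HM). intros eta Heta.
  (* D is the cost of recentring the weight: 9^|k - k0| <= D 9^|k|. *)
  set (D := 9 ^ Z.abs_nat k0).
  assert (HD : 0 < D) by (apply pow_lt; lra).
  set (w := fun k => Rabs (a k) * 9 ^ Z.abs_nat k) in *.
  assert (Hw : forall k, 0 <= w k).
  { intros k. apply Rmult_le_pos; [apply Rabs_pos | apply pow_le; lra]. }
  destruct (small_factor D eta Heta) as (e & He & He').
  destruct (ZsumR_tail w A Hw HA e He) as [N0 HN0].
  (* With this n, |k| <= N0 implies |k - k0| <= n, so the product is exactly the delta on the window
     and only the weighted tail of a is left as error. *)
  set (n := (N0 + Z.abs_nat k0)%nat).
  exists (fun k => sinc_prod k0 n k * a k). split; [eapply sinc_prod_annihilates; eauto|].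
  intros N.
  apply Rle_trans with (ZsumR (fun k => D * (if (Z.abs k <=? Z.of_nat N0)%Z then 0 else w k)) N).
  - apply ZsumR_le; intros k.
    assert (H0 : 0 <= D * (if (Z.abs k <=? Z.of_nat N0)%Z then 0 else w k)).
    { apply Rmult_le_pos; [lra|]. destruct (Z.abs k <=? Z.of_nat N0)%Z; [lra|apply Hw]. }
    destruct (Z.eqb_spec k k0) as [->|Hk].
    + rewrite sinc_prod_center. replace (a k0 - 1 * a k0) with 0 by ring. now rewrite Rabs_R0.
    + destruct (Z_le_gt_dec (Z.abs (k - k0)) (Z.of_nat n)) as [Hle|Hgt].
      * rewrite sinc_prod_zero by lia. replace (0 - 0 * a k) with 0 by ring. now rewrite Rabs_R0.
      * destruct (Z.leb_spec (Z.abs k) (Z.of_nat N0)) as [Hl|Hl]; [unfold n in *; lia|].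
        rewrite Rminus_0_l, Rabs_Ropp, Rabs_mult.
        pose proof (sinc_prod_le k0 n k ltac:(lia)) as Hp.
        assert (Hp9 : 9 ^ Z.abs_nat (k - k0) <= D * 9 ^ Z.abs_nat k).
        { unfold D. rewrite <- pow_add. apply Rle_pow; [lra|lia]. }
        unfold w. pose proof (Rabs_pos (a k)).
        replace (D * (Rabs (a k) * 9 ^ Z.abs_nat k)) with (D * 9 ^ Z.abs_nat k * Rabs (a k)) by ring.
        apply Rmult_le_compat_r; lra.
  - rewrite ZsumR_scal. eapply Rle_trans; [|exact He'].
    apply Rmult_le_compat_l; [lra|].
    eapply Rle_trans; [apply (ZsumR_mono _ N (N + N0)); [|lia]|].
    + intros k. destruct (Z.abs k <=? Z.of_nat N0)%Z; [lra|apply Hw].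
    + rewrite ZsumR_outside by lia. apply HN0. lia.
Qed.

(** * Bessel functions *)

Lemma Un_cv_abs_sub_le (u : nat -> R) l c B n0 : Un_cv u l ->
  (forall n, (n0 <= n)%nat -> Rabs (u n - c) <= B) -> Rabs (l - c) <= B.
Proof.
  intros Hu H. apply Rnot_lt_le; intros Hlt.
  destruct (Hu (Rabs (l - c) - B) ltac:(lra)) as [n1 Hn].
  specialize (Hn (max n0 n1) ltac:(lia)). specialize (H (max n0 n1) ltac:(lia)).
  unfold Rdist in Hn. rewrite Rabs_minus_sym in Hn.
  pose proof (Rabs_triang (l - u (max n0 n1)) (u (max n0 n1) - c)) as T.
  replace (l - u (max n0 n1) + (u (max n0 n1) - c)) with (l - c) in T by ring. lra.
Qed.

(** Keeping the head separate serves two ends: an upper bound for the Bessel functions and, when the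
    head dominates, their nonvanishing. *)
Lemma infinite_sum_sub_head_le u l C z : 0 <= z -> 0 <= C -> infinite_sum u l ->
  (forall k, (1 <= k)%nat -> Rabs (u k) <= C * (/ INR (fact k) * z ^ k)) ->
  Rabs (l - u 0%nat) <= C * exp z.
Proof.
  intros Hz HC Hl Hu. apply (Un_cv_abs_sub_le (sum_f_R0 u) l _ _ 0 Hl). intros n _.
  apply Rle_trans with (C * sum_f_R0 (fun i => / INR (fact i) * z ^ i) n).
  - induction n.
    + simpl. rewrite Rminus_diag, Rabs_R0. lra.
    + cbn [sum_f_R0]. specialize (Hu (S n) ltac:(lia)).
      replace (sum_f_R0 u n + u (S n) - u 0%nat) with (sum_f_R0 u n - u 0%nat + u (S n)) by ring.
      eapply Rle_trans; [apply Rabs_triang|]. lra.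
  - apply Rmult_le_compat_l; auto. now apply exp_partial_sum_le.
Qed.

Lemma bessel_term_abs n x k : 0 <= x ->
  Rabs (bessel_term n x k) =
  (x / 2) ^ n / INR (fact (k + n)) * (/ INR (fact k) * ((x / 2) ^ 2) ^ k).
Proof.
  intros Hx. unfold bessel_term.
  pose proof (INR_fact_lt_0 k) as Hk. pose proof (INR_fact_lt_0 (k + n)) as Hkn.
  assert (0 <= (x / 2) ^ (2 * k + n)) by (apply pow_le; lra).
  unfold Rdiv at 1. rewrite !Rabs_mult, pow_1_abs, Rmult_1_l.
  rewrite (Rabs_right (/ _)), (Rabs_right ((x / 2) ^ _)).
  - rewrite pow_add, pow_mult. field. lra.
  - lra.
  - apply Rle_ge; left; apply Rinv_0_lt_compat, Rmult_lt_0_compat; auto.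
Qed.

(** j = 0 gives convergence and size; j = 1 gains a factor 1 / (n + 1) on all terms after the
    first. *)
Lemma bessel_term_le n x k j : 0 <= x -> (j <= k)%nat ->
  Rabs (bessel_term n x k) <=
  (x / 2) ^ n / INR (fact (j + n)) * (/ INR (fact k) * ((x / 2) ^ 2) ^ k).
Proof.
  intros Hx Hj. rewrite bessel_term_abs by auto. apply Rmult_le_compat_r.
  - apply Rmult_le_pos; [left; apply Rinv_0_lt_compat, INR_fact_lt_0 | apply pow_le, pow2_ge_0].
  - apply Rmult_le_compat_l; [apply pow_le; lra|].
    apply Rinv_le_contravar; [apply INR_fact_lt_0|]. apply le_INR, fact_le. lia.
Qed.

Lemma besselJ_nat_spec n x : 0 <= x -> infinite_sum (bessel_term n x) (besselJ_nat n x).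
Proof.
  intros Hx. unfold besselJ_nat. apply epsilon_spec.
  assert (He : ex_series (bessel_term n x)).
  { apply (ex_series_le (V := R_CompleteNormedModule) _
      (fun k => (x / 2) ^ n / INR (fact (0 + n)) * (/ INR (fact k) * ((x / 2) ^ 2) ^ k))).
    - intros k. apply bessel_term_le; auto; lia.
    - apply (ex_series_scal (V := R_NormedModule)
               ((x / 2) ^ n / INR (fact (0 + n))) (fun k => / INR (fact k) * ((x / 2) ^ 2) ^ k)).
      exists (exp ((x / 2) ^ 2)). apply is_series_Reals. unfold exp.
      destruct (exist_exp ((x / 2) ^ 2)) as [l Hl]; exact Hl. }
  destruct He as [l Hl]. exists l. now apply is_series_Reals.
Qed.

Lemma bessel_term_0 n x : bessel_term n x 0 = (x / 2) ^ n / INR (fact n).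
Proof.
  unfold bessel_term. simpl. pose proof (INR_fact_lt_0 n).
  replace (INR (fact (0 + n))) with (INR (fact n)) by reflexivity. field. lra.
Qed.

Lemma besselJ_nat_le n x : 0 <= x ->
  Rabs (besselJ_nat n x) <= (1 + exp ((x / 2) ^ 2)) * ((x / 2) ^ n / INR (fact n)).
Proof.
  intros Hx. set (C := (x / 2) ^ n / INR (fact n)).
  assert (HC : 0 <= C) by (apply Rmult_le_pos; [apply pow_le; lra | left; apply Rinv_0_lt_compat, INR_fact_lt_0]).
  pose proof (infinite_sum_sub_head_le _ _ C _ (pow2_ge_0 (x / 2)) HC (besselJ_nat_spec n x Hx)
    (fun k _ => bessel_term_le n x k 0 Hx ltac:(lia))) as H.
  rewrite bessel_term_0 in H. fold C in H. apply Rabs_le_between in H. apply Rabs_le. nra.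
Qed.

(** The leading term C = (x/2)^n / n! beats the rest of the series, which is at most C e^{(x/2)^2} /
    (n + 1). *)
Lemma besselJ_nat_neq_0 n x : 0 < x -> exp ((x / 2) ^ 2) < INR (S n) -> besselJ_nat n x <> 0.
Proof.
  intros Hx Hn E. set (C := (x / 2) ^ n / INR (fact n)).
  assert (HC : 0 < C) by (apply Rdiv_lt_0_compat; [apply pow_lt; lra | apply INR_fact_lt_0]).
  assert (HS : 0 < INR (S n)) by (apply lt_0_INR; lia).
  assert (EC : (x / 2) ^ n / INR (fact (1 + n)) = C / INR (S n)).
  { unfold C. change (1 + n)%nat with (S n). rewrite fact_simpl, mult_INR.
    pose proof (INR_fact_lt_0 n). field. lra. }
  assert (HC' : 0 < C / INR (S n)) by now apply Rdiv_lt_0_compat.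
  assert (H : Rabs (besselJ_nat n x - bessel_term n x 0) <= C / INR (S n) * exp ((x / 2) ^ 2)).
  { apply (infinite_sum_sub_head_le (bessel_term n x)); [apply pow2_ge_0|lra|apply besselJ_nat_spec; lra|].
    intros k Hk. rewrite <- EC. apply (bessel_term_le n x k 1); [lra|easy]. }
  rewrite bessel_term_0, E in H. fold C in H.
  rewrite Rminus_0_l, Rabs_Ropp, Rabs_right in H by lra.
  assert (C / INR (S n) * exp ((x / 2) ^ 2) < C / INR (S n) * INR (S n)) by (apply Rmult_lt_compat_l; auto).
  replace (C / INR (S n) * INR (S n)) with C in * by (field; lra). lra.
Qed.

Lemma besselJ_le n x : 0 <= x ->
  Rabs (besselJ n x) <= (1 + exp ((x / 2) ^ 2)) * ((x / 2) ^ Z.abs_nat n / INR (fact (Z.abs_nat n))).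
Proof.
  intros Hx. destruct n as [|p|p].
  - apply (besselJ_nat_le 0 x Hx).
  - apply (besselJ_nat_le (Pos.to_nat p) x Hx).
  - unfold besselJ. rewrite Rabs_mult, pow_1_abs, Rmult_1_l. apply (besselJ_nat_le (Pos.to_nat p) x Hx).
Qed.

Lemma besselJ_eventually_neq_0 x : 0 < x -> exists n0, forall n, (n0 <= n)%Z -> besselJ n x <> 0.
Proof.
  intros Hx. destruct (INR_unbounded (exp ((x / 2) ^ 2))) as [m Hm].
  exists (Z.of_nat (S m)). intros n Hn. destruct n as [|p|p]; [lia| |lia].
  apply besselJ_nat_neq_0; auto. eapply Rlt_le_trans; [exact Hm|]. apply le_INR. lia.
Qed.

Lemma ZsumR_exp_le z N : 0 <= z ->
  ZsumR (fun k => z ^ Z.abs_nat k / INR (fact (Z.abs_nat k))) N <= 2 * exp z.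
Proof.
  intros Hz. apply Rle_trans with (2 * sum_f_R0 (fun i => / INR (fact i) * z ^ i) N).
  - induction N.
    + rewrite ZsumR_0. simpl. lra.
    + rewrite ZsumR_S. cbn [sum_f_R0].
      replace (Z.abs_nat (Z.of_nat (S N))) with (S N) by lia.
      replace (Z.abs_nat (- Z.of_nat (S N))) with (S N) by lia.
      unfold Rdiv in *. lra.
  - pose proof (exp_partial_sum_le z N Hz). lra.
Qed.

Lemma besselJ_bounded x : 0 <= x -> exists E, 0 <= E /\ forall n, Rabs (besselJ n x) <= E.
Proof.
  intros Hx. exists ((1 + exp ((x / 2) ^ 2)) * exp (x / 2)).
  pose proof (exp_pos ((x / 2) ^ 2)). pose proof (exp_pos (x / 2)). split; [nra|]. intros n.
  eapply Rle_trans; [now apply besselJ_le|]. apply Rmult_le_compat_l; [lra|].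
  apply pow_div_fact_le_exp; lra.
Qed.

Lemma besselJ_weighted_summable x : 0 <= x ->
  exists D, 0 <= D /\ forall N, ZsumR (fun k => Rabs (besselJ k x) * 9 ^ Z.abs_nat k) N <= D.
Proof.
  intros Hx. pose proof (exp_pos ((x / 2) ^ 2)) as He.
  (* The factorial absorbs the weight: 9^|k| (x/2)^|k| = (9x/2)^|k|, and every |k| > 0 occurs
     twice. *)
  exists ((1 + exp ((x / 2) ^ 2)) * (2 * exp (9 * (x / 2)))).
  split; [pose proof (exp_pos (9 * (x / 2))); nra|]. intros N.
  eapply Rle_trans; [|apply Rmult_le_compat_l; [lra | apply (ZsumR_exp_le (9 * (x / 2)) N); lra]].
  rewrite <- ZsumR_scal. apply ZsumR_le; intros k. rewrite Rpow_mult_distr.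
  assert (H9 : 0 <= 9 ^ Z.abs_nat k) by (apply pow_le; lra).
  pose proof (Rmult_le_compat_r _ _ _ H9 (besselJ_le k x Hx)) as H. unfold Rdiv in *. lra.
Qed.

Lemma besselJ_summable x : 0 <= x -> summable (fun k => besselJ k x).
Proof.
  intros Hx. destruct (besselJ_weighted_summable x Hx) as (D & _ & HD). exists D; intros N.
  eapply Rle_trans; [|apply HD]. apply ZsumR_le; intros k.
  pose proof (Rabs_pos (besselJ k x)).
  assert (1 <= 9 ^ Z.abs_nat k) by (apply pow_R1_Rle; lra). nra.
Qed.

(** * The forward operator *)

(* Partial sum of the real part of (T rho)(l, theta) for rho = p + i q; its imaginary part is
   obtained by replacing (p, q) with (q, -p). *)
Definition rowsum (j : Z -> R) (l : Z) (p q : Z -> Z -> R) (N : nat) (t : R) : R :=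
  ZsumR (fun m => ZsumR (fun n => j (l - m)%Z * j (l - n)%Z *
    (p m n * cos (IZR (n - m) * t) - q m n * sin (IZR (n - m) * t))) N) N.

Lemma fst_ZsumC f N : fst (ZsumC f N) = ZsumR (fun k => fst (f k)) N.
Proof. unfold ZsumC, ZsumR. induction (Zrange N); simpl; congruence. Qed.
Lemma snd_ZsumC f N : snd (ZsumC f N) = ZsumR (fun k => snd (f k)) N.
Proof. unfold ZsumC, ZsumR. induction (Zrange N); simpl; congruence. Qed.

Lemma fst_Tpartial g rho l t N : fst (Tpartial g rho l t N) =
  rowsum (fun k => besselJ k (2 * Cmod g)) l (fun m n => fst (rho m n)) (fun m n => snd (rho m n)) N t.
Proof.
  unfold Tpartial, rowsum. rewrite fst_ZsumC. apply ZsumR_ext; intros m.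
  rewrite fst_ZsumC. apply ZsumR_ext; intros n.
  (* The phases e^{i(l-m)t} and e^{-i(l-n)t} combine to e^{i(n-m)t}, so l survives only in the
     Bessel factors. *)
  replace (IZR (n - m) * t) with (IZR (l - m) * t - IZR (l - n) * t) by (rewrite !minus_IZR; ring).
  rewrite cos_minus, sin_minus. unfold Tterm, Uentry, Cmul, Cscale, Cexpi, Cconj. simpl. ring.
Qed.

Lemma snd_Tpartial g rho l t N : snd (Tpartial g rho l t N) =
  rowsum (fun k => besselJ k (2 * Cmod g)) l (fun m n => snd (rho m n)) (fun m n => - fst (rho m n)) N t.
Proof.
  unfold Tpartial, rowsum. rewrite snd_ZsumC. apply ZsumR_ext; intros m.
  rewrite snd_ZsumC. apply ZsumR_ext; intros n.
  replace (IZR (n - m) * t) with (IZR (l - m) * t - IZR (l - n) * t) by (rewrite !minus_IZR; ring).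
  rewrite cos_minus, sin_minus. unfold Tterm, Uentry, Cmul, Cscale, Cexpi, Cconj. simpl. ring.
Qed.

Lemma rowsum_minus j l p q p' q' N t :
  rowsum j l (fun m n => p m n - p' m n) (fun m n => q m n - q' m n) N t =
  rowsum j l p q N t - rowsum j l p' q' N t.
Proof.
  unfold rowsum. rewrite <- ZsumR_minus. apply ZsumR_ext; intros m.
  rewrite <- ZsumR_minus. apply ZsumR_ext; intros n. ring.
Qed.

Lemma rowsum_opp j l p q N t :
  rowsum j l (fun m n => - p m n) (fun m n => - q m n) N t = - rowsum j l p q N t.
Proof.
  replace (- rowsum j l p q N t) with (-1 * rowsum j l p q N t) by ring.
  unfold rowsum. rewrite <- ZsumR_scal. apply ZsumR_ext; intros m.
  rewrite <- ZsumR_scal. apply ZsumR_ext; intros n. ring.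
Qed.

Lemma cont_rowsum j l p q N : cont (rowsum j l p q N).
Proof. unfold rowsum. auto 10 with cont. Qed.
#[local] Hint Resolve cont_rowsum : cont.

(** * Uniform convergence of the double series *)

Lemma ZsumR2_mono (f : Z -> Z -> R) N M : (forall m n, 0 <= f m n) -> (N <= M)%nat ->
  ZsumR (fun m => ZsumR (f m) N) N <= ZsumR (fun m => ZsumR (f m) M) M.
Proof.
  intros H HN. eapply Rle_trans; [apply (ZsumR_mono _ N M); auto|].
  - intros m. now apply ZsumR_nonneg.
  - apply ZsumR_le; intros m. now apply ZsumR_mono.
Qed.

(** Both h - f and h + f are nonnegative, so their sums over growing squares increase. *)
Lemma ZsumR2_diff_le (f h : Z -> Z -> R) N M : (forall m n, Rabs (f m n) <= h m n) -> (N <= M)%nat ->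
  Rabs (ZsumR (fun m => ZsumR (f m) M) M - ZsumR (fun m => ZsumR (f m) N) N) <=
  ZsumR (fun m => ZsumR (h m) M) M - ZsumR (fun m => ZsumR (h m) N) N.
Proof.
  intros H HN.
  assert (H1 := ZsumR2_mono (fun m n => h m n - f m n) N M).
  assert (H2 := ZsumR2_mono (fun m n => h m n + f m n) N M).
  assert (E1 : forall K, ZsumR (fun m => ZsumR (fun n => h m n - f m n) K) K =
     ZsumR (fun m => ZsumR (h m) K) K - ZsumR (fun m => ZsumR (f m) K) K).
  { intros. rewrite <- ZsumR_minus. apply ZsumR_ext; intros; apply ZsumR_minus. }
  assert (E2 : forall K, ZsumR (fun m => ZsumR (fun n => h m n + f m n) K) K =
     ZsumR (fun m => ZsumR (h m) K) K + ZsumR (fun m => ZsumR (f m) K) K).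
  { intros. rewrite <- ZsumR_plus. apply ZsumR_ext; intros; apply ZsumR_plus. }
  rewrite !E1 in H1; rewrite !E2 in H2.
  specialize (H1 ltac:(intros m n; specialize (H m n); apply Rabs_le_between in H; lra) HN).
  specialize (H2 ltac:(intros m n; specialize (H m n); apply Rabs_le_between in H; lra) HN).
  apply Rabs_le. lra.
Qed.

Lemma summable_shift j l : summable j -> summable (fun m => j (l - m)%Z).
Proof.
  intros [D HD]. exists D; intros N.
  eapply Rle_trans; [apply (ZsumR_shift_le (fun k => Rabs (j k))); intros; apply Rabs_pos | apply HD].
Qed.

(** The terms are dominated, independently of t, by 2c |j(l-m)| |j(l-n)|, whose sum over a square is
    2c times the square of a one-dimensional sum. *)
Lemma rowsum_cauchy j l p q c : summable j ->
  (forall m n, Rabs (p m n) <= c) -> (forall m n, Rabs (q m n) <= c) ->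
  forall eps, 0 < eps -> exists N0, forall N M t, (N0 <= N <= M)%nat ->
    Rabs (rowsum j l p q M t - rowsum j l p q N t) <= eps.
Proof.
  intros Hj Hp Hq eps He. destruct (summable_shift j l Hj) as [D HD].
  destruct (small_factor (2 * c * (2 * D)) eps He) as (e & Hpos & He').
  destruct (ZsumR_tail _ D (fun k => Rabs_pos _) HD e Hpos) as [N0 HN0].
  set (G := ZsumR (fun k => Rabs (j (l - k)%Z))) in *.
  assert (c0 : 0 <= c) by (eapply Rle_trans; [apply Rabs_pos | apply (Hp 0%Z 0%Z)]).
  exists N0. intros N M t HN.
  assert (EG : forall K, ZsumR (fun m => ZsumR (fun n => 2 * c * (Rabs (j (l - m)%Z) * Rabs (j (l - n)%Z))) K) K
                = 2 * c * (G K * G K)).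
  { intros K. unfold G. rewrite <- ZsumR_scal_r, <- ZsumR_scal. apply ZsumR_ext; intros m.
    rewrite <- ZsumR_scal, <- ZsumR_scal. reflexivity. }
  eapply Rle_trans.
  - apply (ZsumR2_diff_le _ (fun m n => 2 * c * (Rabs (j (l - m)%Z) * Rabs (j (l - n)%Z)))); [|lia].
    intros m n. rewrite !Rabs_mult.
    assert (Hpq : Rabs (p m n * cos (IZR (n - m) * t) - q m n * sin (IZR (n - m) * t)) <= 2 * c).
    { unfold Rminus. eapply Rle_trans; [apply Rabs_triang|]. rewrite Rabs_Ropp, !Rabs_mult.
      pose proof (Hp m n). pose proof (Hq m n).
      assert (Rabs (cos (IZR (n - m) * t)) <= 1) by (apply Rabs_le; apply COS_bound).
      assert (Rabs (sin (IZR (n - m) * t)) <= 1) by (apply Rabs_le; apply SIN_bound).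
      pose proof (Rabs_pos (p m n)). pose proof (Rabs_pos (q m n)). nra. }
    rewrite (Rmult_comm (2 * c)). apply Rmult_le_compat_l; auto.
    apply Rmult_le_pos; apply Rabs_pos.
  - rewrite !EG. specialize (HN0 N M HN).
    assert (HG : forall K, 0 <= G K <= D) by (intros K; split; [apply ZsumR_nonneg; intros; apply Rabs_pos | apply HD]).
    pose proof (HG N). pose proof (HG M).
    assert (HNM : G N <= G M) by (apply ZsumR_mono; [intros; apply Rabs_pos | lia]).
    eapply Rle_trans; [|exact He'].
    replace (2 * c * (G M * G M) - 2 * c * (G N * G N)) with (2 * c * ((G M + G N) * (G M - G N))) by ring.
    rewrite (Rmult_assoc (2 * c)). apply Rmult_le_compat_l; [lra|].
    apply Rmult_le_compat; lra.
Qed.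

Lemma rowsum_converges j l p q c t : summable j ->
  (forall m n, Rabs (p m n) <= c) -> (forall m n, Rabs (q m n) <= c) ->
  exists v, Un_cv (fun N => rowsum j l p q N t) v.
Proof.
  intros Hj Hp Hq. destruct (Rcomplete.R_complete (fun N => rowsum j l p q N t)) as [v Hv]; [|now exists v].
  intros eps He. destruct (rowsum_cauchy j l p q c Hj Hp Hq (eps / 2) ltac:(lra)) as [N0 H].
  exists N0. intros n m Hn Hm. unfold Rdist.
  destruct (Nat.le_ge_cases n m).
  - rewrite Rabs_minus_sym. specialize (H n m t ltac:(lia)). lra.
  - specialize (H m n t ltac:(lia)). lra.
Qed.

(** Off the null set the Cauchy bound passes to the limit 0. Each partial sum is continuous and the
    good points are dense, so the same bound holds everywhere, without forming a limit function. *)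
Lemma rowsum_uniformly_small j l p q c : summable j ->
  (forall m n, Rabs (p m n) <= c) -> (forall m n, Rabs (q m n) <= c) ->
  ae_on_pi (fun t => Un_cv (fun N => rowsum j l p q N t) 0) ->
  forall eps, 0 < eps -> exists N0, forall N t, (N0 <= N)%nat -> - PI <= t <= PI ->
    Rabs (rowsum j l p q N t) <= eps.
Proof.
  intros Hj Hp Hq (S & HS & Hae) eps He.
  destruct (rowsum_cauchy j l p q c Hj Hp Hq eps He) as [N0 H].
  exists N0. intros N t HN Ht.
  assert (Hgood : forall t', - PI <= t' <= PI -> ~ S t' -> Rabs (rowsum j l p q N t') <= eps).
  { intros t' Ht' HSt. specialize (Hae t' Ht' HSt).
    rewrite <- Rabs_Ropp, <- (Rminus_0_l (rowsum _ _ _ _ _ _)).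
    apply (Un_cv_abs_sub_le _ _ _ _ N Hae). intros n Hn. apply H; lia. }
  apply Rnot_lt_le; intros Hlt.
  set (gap := Rabs (rowsum j l p q N t) - eps).
  assert (Hgap : 0 < gap) by (unfold gap; lra).
  destruct (proj1 (filterlim_locally _ _) (cont_rowsum j l p q N t) (mkposreal gap Hgap)) as [delta Hd].
  pose proof (cond_pos delta) as Hdel. pose proof PI_RGT_0.
  (* Clipping to [-pi, pi] handles the endpoints, where only a one-sided neighbourhood is
     available. *)
  destruct (null_set_not_interval S (Rmax (- PI) (t - delta)) (Rmin PI (t + delta)) HS) as (x & Hx & HSx).
  { apply Rmax_lub_lt; apply Rmin_glb_lt; lra. }
  pose proof (Rmax_l (- PI) (t - delta)). pose proof (Rmax_r (- PI) (t - delta)).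
  pose proof (Rmin_l PI (t + delta)). pose proof (Rmin_r PI (t + delta)).
  assert (Hb : Rabs (rowsum j l p q N x - rowsum j l p q N t) < gap).
  { apply (Hd x). apply Rabs_def1; unfold minus, plus, opp; simpl; lra. }
  specialize (Hgood x ltac:(lra) HSx).
  pose proof (Rabs_triang (rowsum j l p q N x) (- (rowsum j l p q N x - rowsum j l p q N t))) as T.
  rewrite Rabs_Ropp in T.
  replace (rowsum j l p q N x + - (rowsum j l p q N x - rowsum j l p q N t)) with (rowsum j l p q N t) in T by ring.
  unfold gap in *. lra.
Qed.

(** The d-th Fourier coefficient, from the real part of e^{-idt} times the partial sum: only n = m +
    d contributes, provided it lies in the summation square. *)
Lemma Int_rowsum_diagonal j l p q N d :
  Int (fun t => cos (IZR d * t) * rowsum j l p q N t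
              + sin (IZR d * t) * rowsum j l q (fun m n => - p m n) N t) =
  2 * PI * ZsumR (fun m => if (Z.abs (m + d) <=? Z.of_nat N)%Z
                           then j (l - m)%Z * j (l - m - d)%Z * p m (m + d)%Z else 0) N.
Proof.
  rewrite (Int_ext _ (fun t => ZsumR (fun m => ZsumR (fun n => j (l - m)%Z * j (l - n)%Z *
    (p m n * cos (IZR (n - m - d) * t) - q m n * sin (IZR (n - m - d) * t))) N) N)).
  - rewrite Int_ZsumR by auto 10 with cont. rewrite <- ZsumR_scal.
    apply ZsumR_ext; intros m. rewrite Int_ZsumR by auto 10 with cont.
    rewrite (ZsumR_ext _ (fun n => if (n =? m + d)%Z then j (l - m)%Z * j (l - n)%Z * (p m n * (2 * PI)) else 0)).
    + rewrite ZsumR_delta. replace (l - (m + d))%Z with (l - m - d)%Z by lia.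
      destruct (Z.abs (m + d) <=? Z.of_nat N)%Z; ring.
    + intros n. rewrite Int_scal, Int_minus, !Int_scal, Int_cos, Int_sin by auto with cont.
      destruct (Z.eqb_spec (n - m - d) 0); destruct (Z.eqb_spec n (m + d)); try lia; ring.
  - intros t. unfold rowsum. rewrite <- !ZsumR_scal, <- ZsumR_plus.
    apply ZsumR_ext; intros m. rewrite <- !ZsumR_scal, <- ZsumR_plus. apply ZsumR_ext; intros n.
    rewrite (minus_IZR (n - m)), Rmult_minus_distr_r, cos_minus, sin_minus. ring.
Qed.

Lemma rowsum_diagonal_zero j l p q c E d : summable j ->
  (forall m n, Rabs (p m n) <= c) -> (forall k, Rabs (j k) <= E) ->
  (forall eps, 0 < eps -> exists N0, forall N t, (N0 <= N)%nat -> - PI <= t <= PI ->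
    Rabs (rowsum j l p q N t) <= eps) ->
  (forall eps, 0 < eps -> exists N0, forall N t, (N0 <= N)%nat -> - PI <= t <= PI ->
    Rabs (rowsum j l q (fun m n => - p m n) N t) <= eps) ->
  Un_cv (ZsumR (fun m => j (l - m)%Z * j (l - m - d)%Z * p m (m + d)%Z)) 0.
Proof.
  intros Hj Hp HE H1 H2 eps He. destruct (summable_shift j l Hj) as [D HD].
  assert (c0 : 0 <= c) by (eapply Rle_trans; [apply Rabs_pos | apply (Hp 0%Z 0%Z)]).
  assert (E0 : 0 <= E) by (eapply Rle_trans; [apply Rabs_pos | apply (HE 0%Z)]).
  destruct (H1 (eps / 6) ltac:(lra)) as [N1 G1]. destruct (H2 (eps / 6) ltac:(lra)) as [N2 G2].
  destruct (small_factor (E * c) (eps / 3) ltac:(lra)) as (e & Hpos & He').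
  destruct (ZsumR_tail _ D (fun k => Rabs_pos _) HD e Hpos) as [N3 HN3].
  exists (N1 + N2 + N3 + Z.abs_nat d)%nat. intros N HN. unfold Rdist. rewrite Rminus_0_r.
  set (f := fun m => j (l - m)%Z * j (l - m - d)%Z * p m (m + d)%Z).
  set (fd := fun m => if (Z.abs (m + d) <=? Z.of_nat N)%Z then f m else 0).
  assert (B1 : Rabs (ZsumR fd N) <= eps / 3).
  { pose proof PI_RGT_0 as HPI.
    pose proof (Int_rowsum_diagonal j l p q N d) as EI.
    apply Rmult_le_reg_l with (2 * PI); [lra|].
    rewrite <- (Rabs_right (2 * PI)) at 1 by lra. rewrite <- Rabs_mult.
    change (2 * PI * ZsumR fd N) with (2 * PI * ZsumR (fun m => if (Z.abs (m + d) <=? Z.of_nat N)%Z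
                           then j (l - m)%Z * j (l - m - d)%Z * p m (m + d)%Z else 0) N).
    rewrite <- EI. apply Int_abs_le; auto with cont. intros t Ht.
    specialize (G1 N t ltac:(lia) Ht). specialize (G2 N t ltac:(lia) Ht).
    eapply Rle_trans; [apply Rabs_triang|]. rewrite !Rabs_mult.
    assert (Rabs (cos (IZR d * t)) <= 1) by (apply Rabs_le; apply COS_bound).
    assert (Rabs (sin (IZR d * t)) <= 1) by (apply Rabs_le; apply SIN_bound).
    pose proof (Rabs_pos (rowsum j l p q N t)).
    pose proof (Rabs_pos (rowsum j l q (fun m n => - p m n) N t)). nra. }
  assert (B2 : Rabs (ZsumR f N - ZsumR fd N) <= eps / 3).
  { rewrite <- ZsumR_minus. eapply Rle_trans; [apply ZsumR_abs|].
    (* The cutoff |m + d| <= N drops only indices with |m| > N - |d|, which belong to the tail of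
       the shifted j. *)
    set (n := (N - Z.abs_nat d)%nat).
    apply Rle_trans with (ZsumR (fun m => E * c * (if (Z.abs m <=? Z.of_nat n)%Z then 0 else Rabs (j (l - m)%Z))) N).
    - apply ZsumR_le; intros m. unfold fd.
      destruct (Z.leb_spec (Z.abs (m + d)) (Z.of_nat N)).
      + rewrite Rminus_diag, Rabs_R0. apply Rmult_le_pos; [nra|].
        destruct (Z.abs m <=? Z.of_nat n)%Z; [lra|apply Rabs_pos].
      + destruct (Z.leb_spec (Z.abs m) (Z.of_nat n)); [unfold n in *; lia|].
        rewrite Rminus_0_r. unfold f. rewrite !Rabs_mult.
        pose proof (HE (l - m - d)%Z). pose proof (Hp m (m + d)%Z).
        rewrite Rmult_assoc, (Rmult_comm (E * c)).
        apply Rmult_le_compat_l; [apply Rabs_pos|]. apply Rmult_le_compat; auto using Rabs_pos.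
    - rewrite ZsumR_scal, ZsumR_outside by (unfold n; lia).
      eapply Rle_trans; [|exact He']. apply Rmult_le_compat_l; [nra|].
      apply HN3. unfold n; lia. }
  apply Rabs_le_between in B1, B2. apply Rabs_def1; lra.
Qed.

(** * Square summability along diagonals and the conclusion *)

Lemma diagonal_sum_le (p : Z -> Z -> R) M d :
  (forall N, ZsumR (fun m => ZsumR (fun n => p m n ^ 2) N) N <= M) ->
  forall N, ZsumR (fun m => p m (m + d)%Z ^ 2) N <= M.
Proof.
  intros H N. eapply Rle_trans; [|apply (H (N + Z.abs_nat d)%nat)].
  eapply Rle_trans; [|apply (ZsumR_mono _ N (N + Z.abs_nat d)); [|lia]].
  - apply ZsumR_le_in; intros m Hm.
    apply (ZsumR_ge_term (fun n => p m n ^ 2)); [intros; apply pow2_ge_0 | lia].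
  - intros m. apply ZsumR_nonneg; intros; apply pow2_ge_0.
Qed.

Lemma square_sum_bounded (p : Z -> Z -> R) M :
  (forall N, ZsumR (fun m => ZsumR (fun n => p m n ^ 2) N) N <= M) ->
  forall m n, Rabs (p m n) <= M + 1.
Proof.
  intros H m n. pose proof (diagonal_sum_le p M (n - m) H (Z.abs_nat m)) as Hd.
  pose proof (ZsumR_ge_term (fun k => p k (k + (n - m))%Z ^ 2) (Z.abs_nat m) m (fun _ => pow2_ge_0 _) ltac:(lia)) as Hk.
  cbv beta in Hk. replace (m + (n - m))%Z with n in Hk by lia.
  rewrite <- pow2_abs in Hk. pose proof (Rabs_pos (p m n)). nra.
Qed.

Lemma is_l2_components rho : is_l2 rho -> exists M,
  (forall N, ZsumR (fun m => ZsumR (fun n => fst (rho m n) ^ 2) N) N <= M) /\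
  (forall N, ZsumR (fun m => ZsumR (fun n => snd (rho m n) ^ 2) N) N <= M).
Proof.
  intros [M HM]. exists M. split; intros N; (eapply Rle_trans; [|apply (HM N)]);
    apply ZsumR_le; intros m; apply ZsumR_le; intros n; unfold Cnorm2;
    pose proof (pow2_ge_0 (fst (rho m n))); pose proof (pow2_ge_0 (snd (rho m n))); lra.
Qed.

Lemma square_sum_minus (p p' : Z -> Z -> R) M M' :
  (forall N, ZsumR (fun m => ZsumR (fun n => p m n ^ 2) N) N <= M) ->
  (forall N, ZsumR (fun m => ZsumR (fun n => p' m n ^ 2) N) N <= M') ->
  forall N, ZsumR (fun m => ZsumR (fun n => (p m n - p' m n) ^ 2) N) N <= 2 * M + 2 * M'.
Proof.
  intros H H' N. specialize (H N). specialize (H' N).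
  apply Rle_trans with (2 * ZsumR (fun m => ZsumR (fun n => p m n ^ 2) N) N
                      + 2 * ZsumR (fun m => ZsumR (fun n => p' m n ^ 2) N) N); [|lra].
  rewrite <- !ZsumR_scal, <- ZsumR_plus. apply ZsumR_le; intros m.
  rewrite <- !ZsumR_scal, <- ZsumR_plus. apply ZsumR_le; intros n.
  pose proof (pow2_ge_0 (p m n + p' m n)). nra.
Qed.

Lemma rowsum_bessel_injective x p q M :
  0 < x -> (forall N, ZsumR (fun m => ZsumR (fun n => p m n ^ 2) N) N <= M) ->
  (forall l eps, 0 < eps -> exists N0, forall N t, (N0 <= N)%nat -> - PI <= t <= PI ->
    Rabs (rowsum (fun k => besselJ k x) l p q N t) <= eps) ->
  (forall l eps, 0 < eps -> exists N0, forall N t, (N0 <= N)%nat -> - PI <= t <= PI ->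
    Rabs (rowsum (fun k => besselJ k x) l q (fun m n => - p m n) N t) <= eps) ->
  forall m n, p m n = 0.
Proof.
  intros Hx HM H1 H2 m n. set (d := (n - m)%Z). replace n with (m + d)%Z by (unfold d; lia).
  destruct (besselJ_bounded x ltac:(lra)) as (E & E0 & HE).
  destruct (besselJ_weighted_summable x ltac:(lra)) as (D & D0 & HD).
  destruct (besselJ_eventually_neq_0 x Hx) as [n0 Hn0].
  (* On the d-th diagonal the equation is a convolution in l. The index n0 + |d| keeps both Bessel
     orders k0 and k0 - d at least n0, where neither value is 0. *)
  apply (convolution_injective (fun k => besselJ k x * besselJ (k - d) x)
           (fun m => p m (m + d)%Z) (E * D) M (n0 + Z.abs d)%Z).
  - intros N. eapply Rle_trans; [|apply Rmult_le_compat_l; [exact E0 | apply (HD N)]].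
    rewrite <- ZsumR_scal. apply ZsumR_le; intros k. rewrite Rabs_mult.
    assert (0 <= Rabs (besselJ k x) * 9 ^ Z.abs_nat k)
      by (apply Rmult_le_pos; [apply Rabs_pos | apply pow_le; lra]).
    pose proof (HE (k - d)%Z). nra.
  - apply Rmult_integral_contrapositive_currified; apply Hn0; lia.
  - now apply diagonal_sum_le.
  - intros l. apply (rowsum_diagonal_zero (fun k => besselJ k x) l p q (M + 1) E d); auto.
    + apply besselJ_summable; lra.
    + now apply square_sum_bounded.
Qed.

Theorem theorem1 :
  forall (g : Cx), g <> C0 ->
  forall rho1 rho2 : Z -> Z -> Cx,
    is_l2 rho1 -> is_l2 rho2 ->
    T_equal g rho1 rho2 ->
    forall m n : Z, rho1 m n = rho2 m n.
Proof.
  intros g Hg rho1 rho2 L1 L2 HT.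
  assert (Hx : 0 < 2 * Cmod g).
  { apply Rmult_lt_0_compat; [lra|]. apply sqrt_lt_R0.
    destruct g as [u v]; simpl fst; simpl snd.
    destruct (Req_dec u 0) as [->|Hu]; [destruct (Req_dec v 0) as [->|Hv]|].
    - now exfalso; apply Hg.
    - pose proof (pow2_gt_0 v Hv). simpl in *; lra.
    - pose proof (pow2_gt_0 u Hu). pose proof (pow2_ge_0 v). lra. }
  set (j := fun k => besselJ k (2 * Cmod g)).
  assert (Hj : summable j) by (apply besselJ_summable; lra).
  destruct (is_l2_components _ L1) as (M1 & P1 & Q1).
  destruct (is_l2_components _ L2) as (M2 & P2 & Q2).
  set (p1 := fun m n => fst (rho1 m n)) in *. set (q1 := fun m n => snd (rho1 m n)) in *.
  set (p2 := fun m n => fst (rho2 m n)) in *. set (q2 := fun m n => snd (rho2 m n)) in *.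
  assert (Bp1 := square_sum_bounded p1 M1 P1). assert (Bq1 := square_sum_bounded q1 M1 Q1).
  assert (Bp2 := square_sum_bounded p2 M2 P2). assert (Bq2 := square_sum_bounded q2 M2 Q2).
  assert (Bn : forall (p : Z -> Z -> R) c, (forall m n, Rabs (p m n) <= c) ->
                forall m n, Rabs (- p m n) <= c) by (intros; rewrite Rabs_Ropp; auto).
  set (p := fun m n => p1 m n - p2 m n). set (q := fun m n => q1 m n - q2 m n).
  assert (SP := square_sum_minus p1 p2 M1 M2 P1 P2). assert (SQ := square_sum_minus q1 q2 M1 M2 Q1 Q2).
  fold p in SP. fold q in SQ.
  assert (Bp := square_sum_bounded p _ SP). assert (Bq := square_sum_bounded q _ SQ).
  assert (Hae : forall l, ae_on_pi (fun t => Un_cv (fun N => rowsum j l p q N t) 0 /\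
             Un_cv (fun N => rowsum j l q (fun m n => - p m n) N t) 0)).
  { intros l. destruct (HT l) as (S & HS & HT'). exists S. split; auto.
    intros t Ht HSt. specialize (HT' t Ht HSt).
    (* [T_equal] compares values only when both series converge, so limits for real and imaginary
       parts of both images are supplied first. *)
    destruct (rowsum_converges j l p1 q1 (M1 + 1) t Hj Bp1 Bq1) as [u1 U1].
    destruct (rowsum_converges j l q1 (fun m n => - p1 m n) (M1 + 1) t Hj Bq1 (Bn _ _ Bp1)) as [v1 V1].
    destruct (rowsum_converges j l p2 q2 (M2 + 1) t Hj Bp2 Bq2) as [u2 U2].
    destruct (rowsum_converges j l q2 (fun m n => - p2 m n) (M2 + 1) t Hj Bq2 (Bn _ _ Bp2)) as [v2 V2].
    assert (Ev : (u1, v1) = (u2, v2)).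
    { apply HT'; split; simpl fst; simpl snd; (eapply Un_cv_ext; [|eassumption]); intros N; cbv beta.
      - now rewrite fst_Tpartial.
      - now rewrite snd_Tpartial.
      - now rewrite fst_Tpartial.
      - now rewrite snd_Tpartial. }
    injection Ev as -> ->. split.
    - rewrite <- (Rminus_diag u2). eapply Un_cv_ext; [|apply (CV_minus _ _ _ _ U1 U2)].
      intros N; cbv beta. symmetry; apply rowsum_minus.
    - rewrite <- (Rminus_diag v2). eapply Un_cv_ext; [|apply (CV_minus _ _ _ _ V1 V2)].
      intros N; cbv beta. rewrite <- rowsum_minus. unfold rowsum, p, q.
      apply ZsumR_ext; intros m. apply ZsumR_ext; intros n. ring. }
  assert (Hsmall1 : forall l eps, 0 < eps -> exists N0, forall N t, (N0 <= N)%nat -> - PI <= t <= PI ->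
    Rabs (rowsum j l p q N t) <= eps).
  { intros l. apply (rowsum_uniformly_small j l p q (2 * M1 + 2 * M2 + 1)); auto.
    destruct (Hae l) as (S & HS & H). exists S; split; auto. intros t Ht HSt. now apply H. }
  assert (Hsmall2 : forall l eps, 0 < eps -> exists N0, forall N t, (N0 <= N)%nat -> - PI <= t <= PI ->
    Rabs (rowsum j l q (fun m n => - p m n) N t) <= eps).
  { intros l. apply (rowsum_uniformly_small j l q _ (2 * M1 + 2 * M2 + 1)); auto.
    destruct (Hae l) as (S & HS & H). exists S; split; auto. intros t Ht HSt. now apply H. }
  assert (Zp : forall m n, p m n = 0) by (apply (rowsum_bessel_injective _ p q _ Hx SP); auto).
  (* Multiplying rho by -i turns (p, q) into (q, -p), so the same lemma applies; its second
     smallness condition is then the first one up to sign. *)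
  assert (Zq : forall m n, q m n = 0).
  { apply (rowsum_bessel_injective _ q (fun m n => - p m n) _ Hx SQ); auto.
    intros l eps He. destruct (Hsmall1 l eps He) as [N0 H]. exists N0; intros N t HN Ht.
    fold j. rewrite rowsum_opp, Rabs_Ropp. auto. }
  intros m n. specialize (Zp m n). specialize (Zq m n). unfold p, p1, p2, q, q1, q2 in *.
  destruct (rho1 m n), (rho2 m n); simpl in *. f_equal; lra.
Qed.
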